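(* Let $\pi=1\pi'\in S_n$, where $\pi'$ is a dominant permutation of $\{2,\ldots,n\}$. For any reduced form of the monomial $m[T(\pi)]$ in the subdivision algebra, $$\tilde{R}_{T(\pi)}(\mathbf{t})=\Big(\prod_{i=1}^{n-1}t_i^{g_i}\Big)\,\mathfrak{G}^{\beta}_{\pi^{-1}}(t_1^{-1},\ldots,t_{n-1}^{-1}),$$ where $g_i$ is the number of boxes in the $i$th column from the left in $R(\pi)$.
   Context: Permutations and diagrams. A permutation $\pi\in S_n$ is written in one-line notation $\pi_1\cdots\pi_n$. Positions in the $n\times n$ grid are (row, column), rows numbered top to bottom and columns left to right. The diagram of $\pi$ is $D(\pi)=\{(\pi_j,i): i<j,\ \pi_i>\pi_j\}$. $\pi=1\pi'$ with $\pi'$ dominant means $\pi_1=1$ and $\pi'=\pi_2\cdots\pi_n$ is a $132$-avoiding permutation of $\{2,\ldots,n\}$; equivalently $D(\pi)$ is the Young diagram of a partition whose north-west most box is at $(2,2)$. Pipe dreams. A pipe dream for $w\in S_n$ is a tiling of the $n\times n$ grid by crosses (two strands cross straight) and elbows (one strand joins the left edge to the top edge, another joins the bottom edge to the right edge) such that all tiles at $(a,b)$ with $a+b\ge n+1$ are elbows, and if the strands entering from the left in rows $1,\ldots,n$ are labelled $1,\ldots,n$ and followed (ignoring second crossings among the same strands), they exit at the top reading $w_1,\ldots,w_n$ from left to right. It is reduced if no two strands cross twice. $PD(w)$ is the simplicial complex with vertices the entries $(a,b)$, $a+b\le n$, and facets the sets of elbow positions (in this triangle) of reduced pipe dreams for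 $w$. $\mathrm{Pipes}(w)$ is the set of all pipe dreams of $w$, reduced and nonreduced; for $P\in\mathrm{Pipes}(w)$, $F(P)$ is the (interior) face of $PD(w)$ given by the elbow positions of $P$. $\beta$-Grothendieck polynomial. $\mathfrak{G}^{\beta}_w(\mathbf{x})=\sum_{P\in\mathrm{Pipes}(w)}\beta^{\mathrm{codim}_{PD(w)}F(P)}\prod_{(i,j)\in\mathrm{cross}(P)}x_i$, where $\mathbf{x}=(x_1,\ldots,x_{n-1})$ and $\mathrm{cross}(P)$ is the set of positions (row $i$, column $j$) of the crosses of $P$. The region $R(\pi)$. The bottom reduced pipe dream of $\pi$ has crosses at the boxes obtained by pushing $D(\pi)$ left (left-justifying each row); the top reduced pipe dream has crosses at the boxes obtained by pushing $D(\pi)$ up. The core region $\mathrm{cr}(\pi)$ is the union of the cross positions of these two pipe dreams, and $R(\pi)=\mathrm{cr}(\pi)\cup\{(1,1)\}$ (so $g_i=0$ if $R(\pi)$ has no box in column $i$). The tree $T(\pi)$. Traverse the southeast boundary of $R(\pi)$ from its SW corner to its NE corner as a sequence of east steps (E) and north steps (N). Let $A$ consist of all N steps together with those E steps such that E bounds the bottom reduced pipe dream (the box of $R(\pi)$ directly above E is a cross of it) but the N step directly preceding E (if the preceding step is an N step) does not bound it (the box directly left of that N step is not a cross of it). Label the steps of $A$ by $1,\ldots,m$ in the order traversed; an E step not in $A$ receives the label of the N step directly preceding it. Place a dot in each box of $R(\pi)$ that is an elbow in the bottom reduced pipe dream, then let the dots in each column drop south so that they occupy the lowest boxes of that column of $R(\pi)$.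 $T(\pi)$ is the (noncrossing) tree on $[m]$ with an edge $(i,j)$, $i<j$, whenever there is a dot in the box in the column of the E step labelled $i$ and the row of the N step labelled $j$. Subdivision algebra. It is the commutative algebra over $\mathbb{Q}[\beta]$ generated by $x_{ij}$, $1\le i<j\le m$, subject to $x_{ij}x_{jk}=x_{ik}(x_{ij}+x_{jk}+\beta)$ for $i<j<k$. A reduced form of a monomial is a polynomial obtained by successively substituting $x_{ik}(x_{ij}+x_{jk}+\beta)$ in place of an occurrence of $x_{ij}x_{jk}$ ($i<j<k$), on each monomial separately, until no further reduction is possible. For a tree $T$, $m[T]=\prod_{(i,j)\in E(T),\,i<j}x_{ij}$. If $i_1<\cdots<i_v$ are the vertices of $T$ having outgoing edges (edges to larger vertices), then $\tilde{R}_T(\mathbf{t})$ is obtained from a reduced form $R_T(x_{ij})$ of $m[T]$ by setting $x_{i_k,j}=t_k$ for all $k\in[v]$ and all $j$ (only such variables occur in a reduced form). *)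

(* Defs.v *)
From HB Require Import structures.
From mathcomp Require Import all_boot all_order all_fingroup all_algebra.
From mathcomp Require Import finmap.
From mathcomp Require Import -(notations) monalg.
From mathcomp Require Import mpoly.

Set Implicit Arguments.
Unset Strict Implicit.
Unset Printing Implicit Defensive.

Import GRing.Theory.

(* Rows, columns, strands and tree vertices are natural numbers starting at 1,
   so that (row, column) = (1, 1) is the north-west box. *)

Definition oneline (n : nat) (w : 'S_n) : seq nat :=
  [seq (w i).+1 | i <- enum 'I_n].

Definition avoids132 (s : seq nat) : Prop :=
  forall i j k, i < j -> j < k -> k < size s ->
    ~~ (nth 0 s i < nth 0 s k < nth 0 s j).

Definition one_dominant (n : nat) (pi : 'S_n) : Prop :=
  head 0 (oneline pi) = 1 /\ avoids132 (behead (oneline pi)).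

(* Rows are values of pi and columns are positions. *)
Definition diagram (n : nat) (pi : 'S_n) (r c : nat) : bool :=
  [exists i : 'I_n, exists j : 'I_n,
    [&& i < j, pi j < pi i, r == (pi j).+1 & c == i.+1]].

(* A pipe dream is given by the set P of its crosses; the box (a, b) is encoded
   as (a - 1, b - 1).  Crosses only occur at a + b <= n, hence in the
   north-west (n-1) x (n-1) square. *)
Definition box (n : nat) : finType := ('I_n.-1 * 'I_n.-1)%type.

Definition triangle (n : nat) : {set box n} :=
  [set x : box n | x.1.+1 + x.2.+1 <= n].

Definition is_cross (n : nat) (P : {set box n}) (a b : nat) : bool :=
  [exists x in P, (x.1.+1 == a) && (x.2.+1 == b)].

(* The strands [lin] and [bin] enter a tile through its left and bottom edges;
   [met] lists the pairs of strands that entered the crosses visited so far,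
   with one entry per cross.  The result gives the strands leaving through the
   right and top edges.  At a cross whose two strands have already crossed, the
   crossing is ignored: the strands turn as at an elbow. *)
Definition through_tile (cross : bool) (met : seq (nat * nat)) (lin bin : nat) :
    nat * nat * seq (nat * nat) :=
  let ij := (minn lin bin, maxn lin bin) in
  if cross then
    if ij \in met then (bin, lin, ij :: met) else (lin, bin, ij :: met)
  else (bin, lin, met).

(* Tiles (a, b), (a, b+1), ... of row a, from left to right; [bins] are the
   strands entering them from below, and the result lists those leaving through
   the top. *)
Fixpoint trace_row (cross : nat -> nat -> bool) (a b : nat)
    (met : seq (nat * nat)) (lin : nat) (bins : seq nat) :
    seq nat * seq (nat * nat) :=
  if bins is bin :: bins' then
    let: (rout, tout, met') := through_tile (cross a b) met lin bin in
    let: (touts, met'') := trace_row cross a b.+1 met' rout bins' in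
    (tout :: touts, met'')
  else ([::], met).

(* The n x n grid, from row n up to row 1.  Strand a enters row a from the left;
   the strands entering the grid from below get the dummy labels n+1, ..., 2n
   and never reach a cross.  This order visits the crosses shared by two strands
   in the order in which these strands go through them. *)
Definition trace (n : nat) (P : {set box n}) : seq nat * seq (nat * nat) :=
  foldl (fun st a => trace_row (is_cross P) a 1 st.2 a st.1)
    (iota n.+1 n, [::]) (rev (iota 1 n)).

Definition Pipes (n : nat) (w : 'S_n) : {set {set box n}} :=
  [set P : {set box n} |
    (P \subset triangle n) && ((trace P).1 == oneline w)].

Definition reduced (n : nat) (P : {set box n}) : bool := uniq (trace P).2.

Definition elbows (n : nat) (P : {set box n}) : {set box n} := triangle n :\: P.

Definition PD (n : nat) (w : 'S_n) : {set {set box n}} :=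
  [set F : {set box n} |
    [exists P in Pipes w, reduced P && (F \subset elbows P)]].

(* dim K - dim F, where a face with d vertices has dimension d - 1 *)
Definition codim (n : nat) (K : {set {set box n}}) (F : {set box n}) : nat :=
  (\max_(G in K) #|G|) - #|F|.

Definition beta : {poly rat} := ('X)%R.

Definition Grothendieck (n : nat) (w : 'S_n) : {mpoly {poly rat}[n.-1]} :=
  (\sum_(P in Pipes w)
     (beta ^+ codim (PD w) (elbows P))%:MP * \prod_(x in P) 'X_(x.1))%R.

Section Region.
Variables (n : nat) (pi : 'S_n).

(* Crosses of the bottom (resp. top) reduced pipe dream: the boxes of the
   diagram pushed left (resp. up). *)
Definition bottom (r c : nat) : bool :=
  1 <= c <= count (diagram pi r) (iota 1 n).

Definition top (r c : nat) : bool :=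
  1 <= r <= count (diagram pi ^~ c) (iota 1 n).

Definition core (r c : nat) : bool := bottom r c || top r c.

Definition region (r c : nat) : bool := core r c || ((r, c) == (1, 1)).

Definition col_length (c : nat) : nat := count (region ^~ c) (iota 1 n).

Definition row_length (r : nat) : nat := count (region r) (iota 1 n).

(* Southeast boundary of the region (a Young diagram), from SW to NE: [inl c]
   is the E step below column c, and [inr r] is the N step at the right end of
   row r. *)
Definition boundary : seq (nat + nat) :=
  flatten
    [seq inl c ::
         [seq inr r | r <- rev (iota (col_length c.+1).+1
                                     (col_length c - col_length c.+1))]
    | c <- iota 1 (row_length 1)].

(* The box of the region directly above an E step (resp. directly left of an
   N step) is a cross of the bottom reduced pipe dream. *)
Definition bounds (s : nat + nat) : bool :=
  match s with
  | inl c => bottom (col_length c) c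
  | inr r => bottom r (row_length r)
  end.

(* Membership in A of the step that comes after the steps [prev].  The initial
   E step bounds the bottom reduced pipe dream as soon as the diagram is
   nonempty; putting it in A unconditionally only affects the identity, where it
   would otherwise have no preceding N step to take its label from. *)
Definition in_A (prev : seq (nat + nat)) (s : nat + nat) : bool :=
  match s with
  | inr _ => true
  | inl _ =>
      nilp prev ||
      bounds s && ~~ (if last s prev is inr r then bounds (inr r) else false)
  end.

Definition in_A_at (p : nat) : bool :=
  in_A (take p boundary) (nth (inl 0) boundary p).

(* The label of a step is the number of steps of A up to and including it; for
   an E step outside A this is the label of the N step directly preceding it. *)
Definition label (s : nat + nat) : nat :=
  count in_A_at (iota 0 (index s boundary).+1).

(* Dots of column c: as many as elbows of the bottom reduced pipe dream in the
   boxes of this column of the region, dropped to its lowest boxes. *)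
Definition ndots (c : nat) : nat :=
  count (fun r => region r c && ~~ bottom r c) (iota 1 n).

Definition dot_rows (c : nat) : seq nat :=
  iota (col_length c - ndots c).+1 (ndots c).

(* The edges of T(pi), the smaller vertex first. *)
Definition tree : seq (nat * nat) :=
  [seq (label (inl c), label (inr r)) | c <- iota 1 (row_length 1),
                                        r <- dot_rows c].

End Region.

(* Monomials and polynomials over Q[beta] in the variables x_ij = x_(i, j);
   only those with i < j are used. *)
Notation xmonom := (monalg.cmonom (nat * nat)%type).
Notation xpoly := (monalg.malg xmonom {poly rat}).

Definition xvar (i j : nat) : xmonom := monalg.ucm (i, j).

Local Notation "m1 ** m2" := (monalg.mul m1 m2)
  (at level 40, left associativity).

Definition xpoly_of_monom (m : xmonom) : xpoly := monalg.mkmalgU m 1%R.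

Definition irreducible_monom (m : xmonom) : Prop :=
  forall i j k, i < j -> j < k -> ~~ ((0 < m (i, j)) && (0 < m (j, k))).

(* [reduced_form m p]: p is a reduced form of m.  A reducible monomial
   x_ij x_jk m is replaced by x_ik x_ij m + x_ik x_jk m + beta x_ik m, and each
   of the three resulting monomials is reduced further, independently of the
   others. *)
Inductive reduced_form : xmonom -> xpoly -> Prop :=
| ReducedDone m of irreducible_monom m : reduced_form m (xpoly_of_monom m)
| ReducedStep i j k m p q r of i < j & j < k
    & reduced_form (xvar i k ** xvar i j ** m) p
    & reduced_form (xvar i k ** xvar j k ** m) q
    & reduced_form (xvar i k ** m) r :
    reduced_form (xvar i j ** xvar j k ** m) (p + q + beta *: r)%R.

Definition tree_monom (T : seq (nat * nat)) : xmonom :=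
  foldr (fun e m => xvar e.1 e.2 ** m) monalg.one T.

(* i_1 < ... < i_v, for T given by its edges, the smaller vertex first *)
Definition outgoing (T : seq (nat * nat)) : seq nat :=
  sort leq (undup (unzip1 T)).

(* t_(k+1), or 0 if it is not one of the N variables *)
Definition tvar (N k : nat) : {mpoly {poly rat}[N]} :=
  if insub k is Some i then 'X_i%R else 0%R.

(* The substitution x_(i_k, j) := t_k *)
Definition tsubst (N : nat) (T : seq (nat * nat)) (p : xpoly) :
    {mpoly {poly rat}[N]} :=
  monalg.mmap (fun c : {poly rat} => c%:MP%R)
    (fun m : xmonom =>
       \prod_(e <- finsupp (monalg.cmonom_val m))
          tvar N (index e.1 (outgoing T)) ^+ m e)%R p.

Definition ratfun (N : nat) : fieldType := {fraction {mpoly {poly rat}[N]}}.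

Definition to_ratfun (N : nat) (p : {mpoly {poly rat}[N]}) : ratfun N :=
  FracField.tofrac p.

(* p(t_1^-1, ..., t_N^-1) *)
Definition eval_inv (N : nat) (p : {mpoly {poly rat}[N]}) : ratfun N :=
  mmap (fun c : {poly rat} => to_ratfun c%:MP%R)
    (fun i : 'I_N => (to_ratfun 'X_i)^-1)%R p.

(* Main.v *)
(* The rational functions x_ij = t_i (t_j + b) / (t_j - t_i) satisfy the relation
   of the subdivision algebra.  Removing polar parts, from the largest t_j down,
   sends an irreducible monomial to the product of the t_i of its factors, so the
   substituted reduced form does not depend on the reductions: for T(pi) it is the
   value at 1 of a product of operators
     f |-> t_i ((t_j + b) f - (t_i + b) f|_{t_j = t_i}) / (t_j - t_i).
   On the other side, the Yang-Baxter equation applied to two adjacent rows of a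
   pipe dream yields the isobaric divided difference recursion for Grothendieck
   polynomials.  With x = 1 / t the two recursions agree column by column of the
   diagram. *)

Require Import Defs.
From mathcomp Require Import all_boot all_order all_fingroup all_algebra.
From mathcomp Require Import finmap.
From mathcomp Require Import -(notations) monalg.
From mathcomp Require Import mpoly.
From mathcomp Require Import ring zify.

Set Implicit Arguments.
Unset Strict Implicit.
Unset Printing Implicit Defensive.

Import GRing.Theory.

(** * Polar parts and reduced forms *)

(** Setting x_ij := t_i does not respect the relation of the algebra, so a reduction must be
    followed through operators, and [D i j] and [D j k] need not commute. This is why the levels
    have a fixed order and why edges are listed so that no source is a later target. On the
    Grothendieck side, 132-avoidance makes the letters that follow c+1 and exceed it increasing. The
    row of the smallest strand then collapses to a power of its variable, which turns the divided
    difference into a recursion removing one strand. The obstacle is to match the two sides. The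
    Grothendieck recursion pairs column c with column c+1, whereas the one edge of column c that
    does not end in a sink leads to the next column h where the diagram columns get shorter. If h =
    c+1 the recursions coincide. Otherwise columns c and c+1 both point to h, and expanding column
    c+1 at three points supplies the missing relation. The comparison is made between values at
    points of a field, because a substitution t_j := t_i merely moves the point; genericity
    conditions keep the denominators nonzero. *)

(* The operators [D i j] below are multiplication by x_ij = t_i (t_j + b) / (t_j - t_i)
   minus the polar part at t_j = t_i, with [x i] for t_i and [S i j] for t_j := t_i. *)
Section PolarPart.

Local Open Scope ring_scope.

Variables (P : idomainType) (n : nat).
Local Notation I := 'I_n.
Variables (b : P) (x : I -> P).
Variables (S : I -> I -> {rmorphism P -> P}) (D : I -> I -> P -> P).
Implicit Types (f g : P) (i j k l a : I).

Hypothesis Sb : forall i j, S i j b = b.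
Hypothesis Sx : forall i j k, S i j (x k) = if k == j then x i else x k.
Hypothesis S_over : forall i j k f, i != k -> S j k (S i k f) = S i k f.
Hypothesis S_move : forall i j a l f, l != i -> l != j -> a != l ->
  S i j (S a l f) = S (if a == j then i else a) l (S i j f).
Hypothesis x_inj : forall i j, i != j -> x j - x i != 0.
Hypothesis DE : forall i j f,
  (x j - x i) * D i j f = x i * ((x j + b) * f - (x i + b) * S i j f).

Lemma S_neq i j k : k != j -> S i j (x k) = x k.
Proof. by rewrite Sx => /negbTE ->. Qed.

Lemma S_same i j : S i j (x j) = x i.
Proof. by rewrite Sx eqxx. Qed.

Lemma D_eq i j f g : i != j ->
  (x j - x i) * g = x i * ((x j + b) * f - (x i + b) * S i j f) -> D i j f = g.
Proof. by move=> ij H; apply: (mulfI (x_inj ij)); rewrite DE H. Qed.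

Lemma D_add i j f g : i != j -> D i j (f + g) = D i j f + D i j g.
Proof. by move=> ij; apply: D_eq => //; rewrite mulrDr !DE rmorphD; ring. Qed.

Lemma D_mul i j f g : i != j -> S i j f = f -> D i j (f * g) = f * D i j g.
Proof. by move=> ij Sf; apply: D_eq => //; rewrite mulrCA DE rmorphM Sf; ring. Qed.

Lemma D_free i j f : i != j -> S i j f = f -> D i j f = x i * f.
Proof. by move=> ij Sf; apply: D_eq => //; rewrite Sf; ring. Qed.

Lemma S_D i j a l f : l != i -> l != j -> a != l ->
  S i j (D a l f) = D (if a == j then i else a) l (S i j f).
Proof.
move=> li lj al; have Xa : S i j (x a) = x (if a == j then i else a).
  by rewrite Sx; case: eqP.
symmetry; apply: D_eq; first by case: ifP => // _; rewrite eq_sym.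
move: (congr1 (S i j) (DE a l f)).
by rewrite !(rmorphM, rmorphB, rmorphD) /= Xa S_neq // Sb (S_move _ li lj al).
Qed.

(** Specializing [DE] at t_k = t_i or t_k = t_j gives the inner polar parts ([Sub]). Once the three
    differences are cleared, both sides are the same combination of f, [S i k f] and [S j k f]. *)
Lemma DC i j k f : i != k -> j != k -> D i k (D j k f) = D j k (D i k f).
Proof.
move=> ik jk; case: (eqVneq i j) => [->//|ij].
have ji : j != i by rewrite eq_sym.
have Sub u v : u != v -> u != k -> v != k -> (x u - x v) * S u k (D v k f) =
    x v * ((x u + b) * S u k f - (x v + b) * S v k f).
  move=> uv uk vk; move: (congr1 (S u k) (DE v k f)).
  by rewrite !(rmorphM, rmorphB, rmorphD) /= Sb S_same (S_neq u vk) S_over.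
apply: (mulfI (x_inj ik)); apply: (mulfI (x_inj jk)); apply: (mulfI (x_inj ij)).
have E1 := DE i k (D j k f); have E2 := DE j k (D i k f).
have F1 := DE i k f; have F2 := DE j k f.
have S1 := Sub _ _ ij ik jk; have S2 := Sub _ _ ji jk ik.
move: E1 E2 F1 F2 S1 S2.
move: (D i k (D j k f)) (D j k (D i k f)) (S i k (D j k f)) (S j k (D i k f)).
move: (D i k f) (D j k f) (S i k f) (S j k f) (x i) (x j) (x k).
move=> di dj si sj xi xj xk a1 a2 a3 a4 E1 E2 F1 F2 S1 S2.
rewrite E1 [in RHS](mulrCA (xk - xj) (xk - xi)) E2.
transitivity (xi * ((xj - xi) * (xk + b) * ((xk - xj) * dj) +
   (xi + b) * (xk - xj) * ((xi - xj) * a3))); first by ring.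
transitivity (xj * ((xj - xi) * (xk + b) * ((xk - xi) * di) -
   (xj + b) * (xk - xi) * ((xj - xi) * a4))); last by ring.
by rewrite F1 F2 S1 S2; ring.
Qed.

(** The coefficients of [D i j] are free of t_l, so [D a l] passes over them, and [S i j] fixes a
    because a differs from j. The case a = i is covered. *)
Lemma D_comm i j a l f : i != j -> a != l -> l != i -> l != j -> a != j ->
  D i j (D a l f) = D a l (D i j f).
Proof.
move=> ij al li lj aj; symmetry; apply: (mulfI (x_inj ij)).
have E : S a l (x j - x i) = x j - x i by rewrite rmorphB /= !S_neq // eq_sym.
rewrite -(D_mul _ al) // !DE S_D // (negbTE aj).
have Exi : S a l (x i) = x i by rewrite S_neq // eq_sym.
have Exj : S a l (x j) = x j by rewrite S_neq // eq_sym.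
have Ej : S a l (x j + b) = x j + b by rewrite rmorphD Exj Sb.
have Ei : S a l (- (x i + b)) = - (x i + b) by rewrite rmorphN rmorphD Exi Sb.
by rewrite (D_mul _ al Exi) -!mulNr (D_add _ _ al) !(D_mul _ al).
Qed.

(** The relation of the algebra for operators: divided by [x j - x i], it says that multiplication
    by x_ij turns [D j k - D i k] into the composite of [D i k] after [D j k] plus b times
    [D i k]. *)
Lemma D_reduce i j k f : i != j -> i != k -> j != k ->
  x i * (x j + b) * (D j k f - D i k f) =
  (x j - x i) * (D i k (D j k f) + b * D i k f).
Proof.
move=> ij ik jk; have ji : j != i by rewrite eq_sym.
have Sub : (x i - x j) * S i k (D j k f) =
    x j * ((x i + b) * S i k f - (x j + b) * S j k f).
  move: (congr1 (S i k) (DE j k f)).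
  by rewrite !(rmorphM, rmorphB, rmorphD) /= Sb S_same (S_neq i jk) S_over.
apply: (mulfI (x_inj ik)); apply: (mulfI (x_inj jk)).
have E1 := DE i k (D j k f).
have F1 := DE i k f; have F2 := DE j k f.
move: E1 F1 F2 Sub.
move: (D i k (D j k f)) (S i k (D j k f)).
move: (D i k f) (D j k f) (S i k f) (S j k f) (x i) (x j) (x k).
move=> di dj si sj xi xj xk a1 a3 E1 F1 F2 S1.
transitivity (xi * (xj + b) * ((xk - xi) * ((xk - xj) * dj) -
   (xk - xj) * ((xk - xi) * di))); first by ring.
transitivity ((xj - xi) * ((xk - xj) * ((xk - xi) * a1) +
   b * (xk - xj) * ((xk - xi) * di))); last by ring.
rewrite E1.
transitivity ((xj - xi) * (xi * ((xk + b) * ((xk - xj) * dj)) +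
  b * (xk - xj) * ((xk - xi) * di)) +
   (xk - xj) * xi * (xi + b) * ((xi - xj) * a3)); last by ring.
by rewrite S1 F1 F2; ring.
Qed.

(** * Truncation of monomials, vertex by vertex *)

Local Notation "m1 ** m2" := (monalg.mul m1 m2) (at level 40, left associativity).
Implicit Types (m : xmonom) (c : I -> nat) (s : seq I).

Definition level_on c k s f : P := foldr (fun i => iter (c i) (D i k)) f s.

Definition below k : seq I := [seq i : I <- enum 'I_n | (i < k)%N].

Definition level m k f : P :=
  level_on (fun i => m (i : nat, k : nat)) k (below k) f.

Definition levels m s f : P := foldr (level m) f s.

(* Vertices are processed from the largest to the smallest, so that a factor of
   degree 0 in t_k reaches the level of a sink k. *)
Definition truncation m : P := levels m (enum 'I_n) 1.

Lemma iter_DC i j k d f : i != k -> j != k ->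
  iter d (D i k) (D j k f) = D j k (iter d (D i k) f).
Proof. by move=> ik jk; elim: d => //= d ->; rewrite DC. Qed.

Lemma level_onC c j k s f : j != k -> {in s, forall i, i != k} ->
  level_on c k s (D j k f) = D j k (level_on c k s f).
Proof.
move=> jk; elim: s => //= i s IH sk; have ik : i != k by rewrite sk ?mem_head.
by rewrite IH ?iter_DC // => l ls; rewrite sk // inE ls orbT.
Qed.

Lemma level_on_eq c c' k s f : {in s, c =1 c'} -> level_on c k s f = level_on c' k s f.
Proof.
elim: s => //= i s IH E; rewrite (E i) ?mem_head // IH // => l ls.
by rewrite E // inE ls orbT.
Qed.

Lemma level_on0 c k s f : {in s, forall i, c i = 0%N} -> level_on c k s f = f.
Proof.
elim: s => //= i s IH E; rewrite (E i) ?mem_head //= IH // => l ls.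
by rewrite E // inE ls orbT.
Qed.

Lemma level_on_incr c j k s f : uniq s -> j \in s -> {in s, forall i, i != k} ->
  level_on (fun i => (i == j) + c i)%N k s f = D j k (level_on c k s f).
Proof.
elim: s => //= i s IH /andP[si us]; rewrite inE.
case: (eqVneq j i) => [->|ji] /= js sk.
  congr (D i k (iter _ _ _)); apply: level_on_eq => l ls.
  by case: eqP => // li; rewrite -li ls in si.
rewrite IH //; last by move=> l ls; rewrite sk // inE ls orbT.
by rewrite iter_DC // sk // inE ?eqxx ?js ?orbT.
Qed.

Lemma xvarE (u v : nat) m e : (xvar u v ** m) e = (((u, v) == e) + m e)%N.
Proof. by rewrite monalg.cmM monalg.cmU. Qed.

Lemma mem_below k : {in (below k), forall i : I, (i < k)%N}.
Proof. by move=> i; rewrite /below mem_filter => /andP[]. Qed.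

Lemma below_uniq k : uniq (below k).
Proof. by rewrite filter_uniq ?enum_uniq. Qed.

Lemma below_neq k : {in (below k), forall i : I, i != k}.
Proof. by move=> i /mem_below ik; rewrite neq_ltn ik. Qed.

Lemma level_incr m i k f : (i < k)%N -> level (xvar i k ** m) k f = D i k (level m k f).
Proof.
move=> ik; rewrite -level_on_incr ?below_uniq //.
- by apply: level_on_eq => l _; rewrite xvarE xpair_eqE eqxx andbT eq_sym.
- by rewrite mem_filter ik mem_enum.
- exact: below_neq.
Qed.

Lemma level_neq m i j k f : j != k -> level (xvar i j ** m) k f = level m k f.
Proof.
move=> jk; apply: level_on_eq => l _; rewrite xvarE xpair_eqE.
by rewrite [_ == k :> nat](negbTE jk) andbF.
Qed.

Lemma levelC m j k f : j != k -> level m k (D j k f) = D j k (level m k f).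
Proof. by move=> jk; apply: level_onC => //; exact: below_neq. Qed.

Lemma levels_neq m i j s f : j \notin s ->
  levels (xvar i j ** m) s f = levels m s f.
Proof.
elim: s => //= k s IH; rewrite inE negb_or => /andP[jk js].
by rewrite IH // level_neq.
Qed.

Lemma iter_D_add i k d f g : i != k ->
  iter d (D i k) (f + g) = iter d (D i k) f + iter d (D i k) g.
Proof. by move=> ik; elim: d => //= d ->; rewrite D_add. Qed.

Lemma level_add m k f g : level m k (f + g) = level m k f + level m k g.
Proof.
rewrite /level; move: (below k) (@below_neq k); elim=> //= i s IH sk.
rewrite IH ?iter_D_add ?sk ?mem_head // => l ls.
by rewrite sk // inE ls orbT.
Qed.

Lemma levels_add m s f g : levels m s (f + g) = levels m s f + levels m s g.
Proof. by elim: s => //= k s ->; rewrite level_add. Qed.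

Lemma level_mul m k h f : (forall l, S l k h = h) ->
  level m k (h * f) = h * level m k f.
Proof.
move=> Sh; rewrite /level; move: (below k) (@below_neq k); elim=> //= i s IH sk.
have ik : i != k by rewrite sk ?mem_head.
rewrite IH; last by move=> l ls; rewrite sk // inE ls orbT.
by elim: (m _) => //= d ->; rewrite D_mul.
Qed.

Lemma levels_mul m s h f : (forall l k, k \in s -> S l k h = h) ->
  levels m s (h * f) = h * levels m s f.
Proof.
elim: s => //= k s IH Sh; rewrite IH; last first.
  by move=> l k' ks; rewrite Sh // inE ks orbT.
by rewrite level_mul // => l; rewrite Sh // mem_head.
Qed.

Lemma level_subst m i j k f g : k != i -> k != j ->
  S i j f = S i j g -> S i j (level m k f) = S i j (level m k g).
Proof.
move=> ki kj E; rewrite /level; move: (below k) (@below_neq k); elim=> //= l s IH sk.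
have lk : l != k by rewrite sk ?mem_head.
elim: (m _) => /= [|d IHd]; last by rewrite !S_D // IHd.
by apply: IH => l' ls; rewrite sk // inE ls orbT.
Qed.

Lemma levels_subst m i j s f g : i \notin s -> j \notin s ->
  S i j f = S i j g -> S i j (levels m s f) = S i j (levels m s g).
Proof.
elim: s => //= k s IH; rewrite !inE !negb_or => /andP[ik i_s] /andP[jk js] E.
by apply: level_subst; rewrite 1?eq_sym // IH.
Qed.

Lemma notin_lt s k : {in s, forall l : I, (l < k)%N} -> k \notin s.
Proof. by move=> ks; apply/negP => /ks; rewrite ltnn. Qed.

Lemma notin_gt s k : {in s, forall l : I, (k < l)%N} -> k \notin s.
Proof. by move=> ks; apply/negP => /ks; rewrite ltnn. Qed.

Lemma enum_ord_pairwise : pairwise (fun i j : I => (i < j)%N) (enum 'I_n).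
Proof.
have : sorted ltn (map val (enum 'I_n)) by rewrite val_enum_ord iota_ltn_sorted.
by rewrite sorted_pairwise ?pairwise_map //; exact: ltn_trans.
Qed.

Lemma enum_ord_split k : exists s1 s2, [/\ enum 'I_n = s1 ++ k :: s2,
  {in s1, forall l : I, (l < k)%N} & {in s2, forall l : I, (k < l)%N}].
Proof.
have [s1 [s2 E]] : exists s1 s2, enum 'I_n = s1 ++ k :: s2.
  by have := mem_enum 'I_n k; rewrite inE => /path.splitPr [s1 s2]; exists s1, s2.
have := enum_ord_pairwise; rewrite E pairwise_cat /=.
case/and3P=> [/allrelP s1s _ /andP[/allP s2s _]]; exists s1, s2; split=> // l ls.
by apply: s1s; rewrite ?mem_head.
Qed.

Lemma enum_ord_split2 j k : (j < k)%N -> exists s1 s2 s3,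
  [/\ enum 'I_n = s1 ++ j :: s2 ++ k :: s3, {in s1, forall l : I, (l < j)%N},
    {in s2, forall l : I, (j < l < k)%N} & {in s3, forall l : I, (k < l)%N}].
Proof.
move=> jk; have [s1 [s [E s1j sj]]] := enum_ord_split j.
have ks : k \in s.
  have : k \in enum 'I_n by rewrite mem_enum.
  rewrite E mem_cat inE => /or3P[/s1j|/eqP kj|//]; first by rewrite ltnNge ltnW.
  by rewrite kj ltnn in jk.
case/path.splitPr: ks E sj => s2 s3 E sj; exists s1, s2, s3.
have := enum_ord_pairwise; rewrite E pairwise_cat /= pairwise_cat /=.
case/and3P=> _ _ /andP[_ /and3P[]].
move=> /allrelP s2k _ /andP[/allP s3k _].
split=> // l ls.
by rewrite sj ?mem_cat ?ls // s2k ?mem_head.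
Qed.

Lemma levels_cat m s1 s2 f : levels m (s1 ++ s2) f = levels m s1 (levels m s2 f).
Proof. by rewrite /levels foldr_cat. Qed.

(** The new factor sits at level j and has to travel out through the levels k < j. By [D_comm] only
    level i could stop it, and that level is empty. *)
Lemma truncation_incr m i j : (i < j)%N -> (forall a : nat, m (a, i : nat) = 0%N) ->
  truncation (xvar i j ** m) = D i j (truncation m).
Proof.
move=> ij mi; rewrite /truncation.
have [s1 [s2 [-> s1j s2j]]] := enum_ord_split j.
rewrite !levels_cat /= level_incr // !levels_neq ?(notin_lt s1j) ?(notin_gt s2j) //.
move: (level m j _) => f; elim: s1 s1j => //= k s IH sk.
rewrite IH; last by move=> l ls; rewrite sk // inE ls orbT.
have {sk} kj : (k < j)%N by rewrite sk ?mem_head.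
case: (eqVneq k i) => [ki|ki].
  have lev0 g : level m k g = g by apply: level_on0 => l _; rewrite ki.
  by rewrite !lev0.
rewrite /level; move: (below k) (@mem_below k); elim=> //= l t IHt tk.
have lk : (l < k)%N by rewrite tk ?mem_head.
rewrite IHt; last by move=> l' lt; rewrite tk // inE lt orbT.
have ij' : i != j by rewrite neq_ltn ij.
have lk' : l != k by rewrite neq_ltn lk.
have kj' : k != j by rewrite neq_ltn kj.
have lj' : l != j by rewrite neq_ltn (ltn_trans lk kj).
by elim: (m _) => //= d ->; rewrite (D_comm _ ij' lk').
Qed.

(** The two values fed to [D i j] agree at t_j = t_i, so their difference has no polar part and
    [D i j] multiplies it by x_ij. This multiplication commutes with the levels in [s], which
    involve neither i nor j as targets, and reaches [D_reduce]. *)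
Lemma levels_reduce m i j k s f : (i < j)%N -> (j < k)%N -> i \notin s -> j \notin s ->
  k \notin s ->
  D i j (levels m s (D j k f)) =
  D i j (levels m s (D i k f)) +
    levels m s (D i k (D j k f) + b * D i k f).
Proof.
move=> ltij ltjk i_s j_s k_s.
have ij : i != j by rewrite neq_ltn ltij.
have jk : j != k by rewrite neq_ltn ltjk.
have ik : i != k by rewrite neq_ltn (ltn_trans ltij).
have Ss h l : l \in s -> (h == i) || (h == j) -> forall a, S a l (x h) = x h.
  move=> ls hij a; rewrite S_neq //; apply: contraTneq ls => <-.
  by case/orP: hij => /eqP ->.
have Si l a : a \in s -> S l a (x i) = x i by move=> /Ss ->; rewrite ?eqxx.
have Sj l a : a \in s -> S l a (x j) = x j by move=> /Ss ->; rewrite ?eqxx ?orbT.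
apply: (mulfI (x_inj ij)).
rewrite mulrDr !DE; set W1 := levels m s (D j k f); set W2 := levels m s (D i k f).
have ES : S i j W1 = S i j W2.
  by apply: levels_subst => //; rewrite !S_D ?eqxx ?(negbTE ij) // eq_sym.
have EW : x i * (x j + b) * (W1 - W2) =
    (x j - x i) * levels m s (D i k (D j k f) + b * D i k f).
  rewrite -levels_mul; last by move=> l a As; rewrite rmorphB /= Si ?Sj.
  rewrite -D_reduce // levels_mul; last first.
    by move=> l a As; rewrite rmorphM rmorphD /= Si ?Sj ?Sb.
  congr (_ * _); rewrite levels_add; congr (_ + _).
  rewrite -[- D i k f]mulN1r levels_mul ?mulN1r // => l a _.
  by rewrite rmorphN rmorph1.
by rewrite -EW ES; ring.
Qed.

Lemma truncation_reduce m i j k : (i < j)%N -> (j < k)%N ->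
  truncation (xvar i j ** xvar j k ** m) =
  truncation (xvar i k ** xvar i j ** m) + truncation (xvar i k ** xvar j k ** m)
  + b * truncation (xvar i k ** m).
Proof.
move=> ij jk; have ik := ltn_trans ij jk.
have nij : i != j by rewrite neq_ltn ij.
have njk : j != k by rewrite neq_ltn jk.
have nik : i != k by rewrite neq_ltn ik.
rewrite /truncation -!monalg.mulmA.
have [s1 [s [s3 [-> s1j sjk s3k]]]] := enum_ord_split2 jk.
have js1 := notin_lt s1j; have ks3 := notin_gt s3k.
have ks1 : k \notin s1 by apply: contraL jk => /s1j; rewrite -leqNgt; exact: ltnW.
have js3 : j \notin s3 by apply: contraL jk => /s3k; rewrite -leqNgt; exact: ltnW.
have i_s : i \notin s by apply: contraL ij => /sjk /andP[+ _]; rewrite -leqNgt; exact: ltnW.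
have j_s : j \notin s by apply/negP => /sjk; rewrite ltnn.
have k_s : k \notin s by apply/negP => /sjk; rewrite ltnn andbF.
have nkj : k != j by rewrite eq_sym.
rewrite !levels_cat /= !levels_cat /=.
rewrite !(levels_neq _ _ _ js1, levels_neq _ _ _ ks1, levels_neq _ _ _ js3,
          levels_neq _ _ _ ks3, levels_neq _ _ _ j_s, levels_neq _ _ _ k_s).
rewrite !(level_incr _ _ ij, level_incr _ _ jk, level_incr _ _ ik,
          level_neq _ _ _ njk, level_neq _ _ _ nkj).
set g := level m k _.
(* [D i j] is first moved inside the rest of level j, so that only the levels strictly between j and
   k separate it from [D j k]. *)
have -> : D i j (level m j (levels m s (D j k g))) =
    level m j (D i j (levels m s (D i k g)) + levels m s (D i k (D j k g))
      + b * levels m s (D i k g)).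
  rewrite -levelC // (levels_reduce _ _ ij jk) //; congr (level m j _).
  by rewrite levels_add addrA levels_mul.
rewrite !level_add !levels_add levelC // level_mul // levels_mul //.
Qed.

(** In an irreducible monomial a vertex k with an incoming factor has no outgoing one. The product
    built from the larger vertices is therefore free of t_k, and each [D i k] acts on it as
    multiplication by [x i]. *)
Lemma levels_irreducible m s : pairwise (fun i j : I => (i < j)%N) s ->
  (forall i j k : I, (i < j)%N -> (j < k)%N -> ~~ ((0 < m (i : nat, j : nat)) && (0 < m (j : nat, k : nat)))%N) ->
  levels m s 1 = \prod_(k <- s) \prod_(i <- below k) x i ^+ m (i : nat, k : nat).
Proof.
move=> + irr; elim: s => [|k s IH] /=; first by rewrite big_nil.
rewrite big_cons => /andP[/allP ks /IH ->]; set f := \prod_(_ <- s) _.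
case: (boolP (has (fun i : I => 0 < m (i : nat, k : nat))%N (below k))) => [/hasP[i iks mik]|].
  have ik := mem_below iks.
  have Sf a : S a k f = f.
    rewrite rmorph_prod; apply: eq_big_seq => l ls; rewrite rmorph_prod.
    apply: eq_bigr => j _; rewrite rmorphXn /=.
    case: (eqVneq j k) => [->|jk]; last by rewrite S_neq.
    by have := irr i k l ik (ks l ls); rewrite mik /= -eqn0Ngt => /eqP ->; rewrite !expr0.
  rewrite /level; move: (below k) (@mem_below k) => t; elim: t => [|j t IHt] tk /=.
    by rewrite big_nil mul1r.
  have jk : j != k by rewrite neq_ltn tk ?mem_head.
  rewrite big_cons -mulrA IHt; last by move=> l lt; rewrite tk // inE lt orbT.
  set g := _ * f; have Sg a : S a k g = g.
    rewrite rmorphM Sf rmorph_prod /=; congr (_ * _); apply: eq_big_seq => l lt.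
    by rewrite rmorphXn /= S_neq // neq_ltn tk // inE lt orbT.
  have Sd d : S j k (x j ^+ d * g) = x j ^+ d * g by rewrite rmorphM rmorphXn /= S_neq // Sg.
  elim: (m _) => [|d IHd] /=; first by rewrite expr0 mul1r.
  by rewrite IHd D_free ?Sd // exprS mulrA.
rewrite -all_predC => /allP m0; rewrite big1_seq ?mul1r => [|i /andP[_ /m0]].
  by rewrite /level level_on0 // => i /m0 /=; rewrite -eqn0Ngt => /eqP.
by rewrite /= -eqn0Ngt => /eqP ->.
Qed.

Section Evaluation.

Variables (K : comNzRingType) (phi : {rmorphism {poly rat} -> K}).
Variables (ev : {rmorphism P -> K}) (t : nat -> K).
Hypothesis ev_b : ev b = phi beta.
Hypothesis ev_x : forall i, ev (x i) = t i.

(** Here t is indexed by the vertex itself, not by its rank among the sources as in [tsubst]; the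
    ranks enter only through the choice of t. *)
Definition source_monom m : K := \prod_(e <- finsupp (monalg.cmonom_val m)) t e.1 ^+ m e.

Lemma mmap_scale (h : xmonom -> K) (c : {poly rat}) (p : xpoly) :
  monalg.mmap phi h (c *: p) = phi c * monalg.mmap phi h p.
Proof.
rewrite (monalg.mmapEw (monalg.msuppZ_le _ _)) monalg.mmapE mulr_sumr.
by apply: eq_bigr => m _; rewrite monalg.mcoeffZ /= rmorphM mulrA.
Qed.

Lemma truncation_irreducible m : irreducible_monom m ->
  (forall e, (0 < m e)%N -> (e.1 < e.2 < n)%N) -> ev (truncation m) = source_monom m.
Proof.
move=> irr bd; rewrite /truncation levels_irreducible ?enum_ord_pairwise //; last first.
  by move=> i j k ij jk; exact: irr.
pose F e := t e.1 ^+ m e; pose A := [seq ((i : nat), (k : nat)) | k : I <- enum 'I_n, i <- below k].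
have -> : ev (\prod_(k <- enum 'I_n) \prod_(i <- below k) x i ^+ m (i : nat, k : nat)) = \prod_(e <- A) F e.
  rewrite rmorph_prod big_allpairs_dep; apply: eq_bigr => k _.
  by rewrite rmorph_prod; apply: eq_bigr => i _; rewrite rmorphXn /= ev_x.
have uA : uniq A.
  apply: allpairs_uniq_dep => [|k _|]; [exact: enum_uniq|exact: below_uniq|].
  by move=> [k i] [k' i'] _ _ /= [/val_inj -> /val_inj ->].
rewrite (bigID (fun e => 0 < m e)%N) /= mulrC big1 ?mul1r => [|e]; last first.
  by rewrite -eqn0Ngt /F => /eqP ->; rewrite expr0.
rewrite -big_filter; apply: perm_big; apply: uniq_perm; rewrite ?filter_uniq ?fset_uniq //.
move=> [u v]; rewrite mem_filter -monalg.cmE_neq0 -lt0n.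
case: (posnP (m (u, v))) => [//|/bd /andP[/= uv vn]] //=.
apply/(@allpairsPdep I (fun=> I) _ (fun k i : I => (i : nat, k : nat)) (enum 'I_n) below).
exists (Ordinal vn), (Ordinal (ltn_trans uv vn)); split; rewrite ?mem_enum //.
by rewrite mem_filter mem_enum andbT.
Qed.

(** Induction on the reduction: [truncation_reduce] handles a step, and the bound on the indices
    survives because i, j and k already occur in the monomial. *)
Lemma reduced_form_truncation m p : reduced_form m p ->
  (forall e, (0 < m e)%N -> (e.1 < e.2 < n)%N) ->
  monalg.mmap phi source_monom p = ev (truncation m).
Proof.
elim=> [{}m irr bd|i j k {}m p1 p2 p3 ij jk _ IH1 _ IH2 _ IH3 bd].
  rewrite monalg.mmapU /= rmorph1 mul1r truncation_irreducible //.
have bdm e : (0 < m e)%N -> (e.1 < e.2 < n)%N.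
  by move=> me; apply: bd; rewrite -monalg.mulmA !xvarE !addn_gt0 me !orbT.
have /andP[_ kn] : (j < k < n)%N.
  by apply: (bd (j, k)); rewrite -monalg.mulmA !xvarE eqxx addnCA.
have jn := ltn_trans jk kn; have ni := ltn_trans ij jn; have ik := ltn_trans ij jk.
have bd1 u v (mm : xmonom) : (u < v < n)%N -> (forall e, (0 < mm e)%N -> (e.1 < e.2 < n)%N) ->
    forall e, (0 < (xvar u v ** mm) e)%N -> (e.1 < e.2 < n)%N.
  by move=> uv bdmm e; rewrite xvarE; case: eqP => [<-|_ /bdmm].
rewrite !monalg.mmapD mmap_scale IH1 ?IH2 ?IH3; first 1 last.
- by apply: bd1 => //; rewrite ik.
- by rewrite -monalg.mulmA; apply: (bd1); rewrite ?ik //; apply: bd1; rewrite ?jk.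
- by rewrite -monalg.mulmA; apply: (bd1); rewrite ?ik //; apply: bd1; rewrite ?ij.
have -> := @truncation_reduce m (Ordinal ni) (Ordinal jn) (Ordinal kn) ij jk.
by rewrite !rmorphD rmorphM ev_b.
Qed.

End Evaluation.

Lemma tree_monomE T e : tree_monom T e = count_mem e T.
Proof. by elim: T => [|[u v] T IH] /=; rewrite ?monalg.cm1 // xvarE IH. Qed.

Definition tree_poly T : P :=
  foldr (fun e f => if (insub e.1, insub e.2) is (Some i, Some j) then D i j f else f) 1 T.

(** The order condition on [T] says that the source of the head edge receives nothing from the tail,
    which is what [truncation_incr] needs to put that edge outermost. *)
Lemma truncation_tree T : all (fun e : nat * nat => e.1 < e.2 < n)%N T ->
  pairwise (fun e e' : nat * nat => e.1 != e'.2) T ->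
  truncation (tree_monom T) = tree_poly T.
Proof.
elim: T => [_ _|[u v] T IH /= /andP[/andP[uv vn] aT] /andP[uT pT]].
  rewrite /truncation /=; elim: (enum 'I_n) => //= k s ->.
  by apply: level_on0 => i _; rewrite monalg.cm1.
rewrite (insubT (fun i : nat => (i < n)%N) (ltn_trans uv vn)) (insubT (fun i : nat => (i < n)%N) vn) /= -IH //.
have := @truncation_incr (tree_monom T) (Ordinal (ltn_trans uv vn)) (Ordinal vn) uv; apply.
move=> a; rewrite tree_monomE; apply/count_memPn/negP => aT'.
by move/allP: uT => /(_ _ aT') /=; rewrite eqxx.
Qed.
End PolarPart.

(** * Rows of pipe dreams and divided differences *)

Section Rows.

Local Open Scope ring_scope.

Variables (K : comNzRingType) (b : K).
Implicit Types (x y : K) (phi psi : seq nat -> K) (s u p r : seq nat).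

(* The strand l enters a row from the left and the strands s from below; [phi]
   is evaluated at the strands that leave, with weight x for a crossing and b x
   for a cross whose strands have already crossed. *)
Fixpoint row_sum x phi (l : nat) s : K :=
  if s is h :: s' then
    row_sum x (phi \o cons l) h s' +
    (if (l < h)%N then x * row_sum x (phi \o cons h) l s'
     else b * x * row_sum x (phi \o cons l) h s')
  else phi [:: l].

Lemma row_sum_perm x phi psi l s :
  (forall u, perm_eq u (l :: s) -> phi u = psi u) ->
  row_sum x phi l s = row_sum x psi l s.
Proof.
elim: s l phi psi => [|h s IH] l phi psi E /=; first exact: E.
rewrite (IH h _ (psi \o cons l)); last by move=> u us; apply: E; rewrite perm_cons.
rewrite (IH l _ (psi \o cons h)) // => u us; apply: E.
apply: (@perm_trans _ (h :: l :: s)); first by rewrite perm_cons.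
by rewrite -(cat1s h) -(cat1s l) perm_catCA.
Qed.

Lemma eq_row_sum x phi psi l s : phi =1 psi -> row_sum x phi l s = row_sum x psi l s.
Proof. by move=> E; apply: row_sum_perm. Qed.

Lemma row_sumD x phi psi l s :
  row_sum x (fun u => phi u + psi u) l s = row_sum x phi l s + row_sum x psi l s.
Proof.
elim: s l phi psi => //= h s IH l phi psi.
rewrite (IH h (phi \o cons l) (psi \o cons l)) (IH l (phi \o cons h) (psi \o cons h)).
by case: ifP => _; ring.
Qed.

Lemma row_sumZ x a phi l s : row_sum x (fun u => a * phi u) l s = a * row_sum x phi l s.
Proof.
elim: s l phi => //= h s IH l phi.
rewrite (IH h (phi \o cons l)) (IH l (phi \o cons h)).
by case: ifP => _; ring.
Qed.

Lemma row_sum0 x phi l s : phi =1 (fun=> 0) -> row_sum x phi l s = 0.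
Proof.
move=> phi0; rewrite (eq_row_sum _ _ _ (psi := fun u => 0 * phi u)) ?row_sumZ ?mul0r //.
by move=> u; rewrite phi0 mul0r.
Qed.

Lemma row_sum_map x phi l s (f : nat -> nat) :
  {in l :: s &, {mono f : i j / (i < j)%N}} ->
  row_sum x phi (f l) (map f s) = row_sum x (phi \o map f) l s.
Proof.
elim: s l phi => //= h s IH l phi fm.
rewrite fm ?mem_head ?inE ?eqxx ?orbT // !IH //.
  by apply: sub_in2 fm => i; rewrite !inE => /orP[] ->; rewrite ?orbT.
by apply: sub_in2 fm => i; rewrite !inE => /orP[] ->; rewrite ?orbT.
Qed.

(** The row of parameter y, entered by j, lies below the row of parameter x, entered by i. *)
Definition two_rows x y phi i j s : K := row_sum y (row_sum x phi i) j s.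

(** The upper box of a column whose lower box is settled: i enters it from the left, j from below,
    while h continues along the lower row. *)
Definition tile x y phi (i j h : nat) s : K :=
  two_rows x y (phi \o cons i) j h s +
  (if (i < j)%N then x * two_rows x y (phi \o cons j) i h s
   else b * x * two_rows x y (phi \o cons i) j h s).

Lemma two_rows_cons x y phi i j h s :
  two_rows x y phi i j (h :: s) = tile x y phi i j h s +
  (if (j < h)%N then y * tile x y phi i h j s else b * y * tile x y phi i j h s).
Proof.
have E k l : row_sum y (row_sum x phi i \o cons k) l s = tile x y phi i k l s.
  rewrite /tile /two_rows -!row_sumZ; case: ifP => ik; rewrite -row_sumD.
    by apply: eq_row_sum => u /=; rewrite ik.
  by apply: eq_row_sum => u /=; rewrite ik.
by rewrite -!E.
Qed.

(* The Yang-Baxter equation lets the crossing with parameter (y - x) / (1 + b x)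
   travel from the left of the two rows to their right, exchanging x and y. *)
Lemma two_rows_swap x y phi i j s :
  (1 + b * x) * two_rows x y phi i j s +
  (y - x) * (if (i < j)%N then two_rows x y phi j i s else b * two_rows x y phi i j s) =
  (1 + b * x) * two_rows y x phi i j s.
Proof.
elim: s i j phi => [|h s IH] i j phi.
  by rewrite /two_rows /=; case: ltngtP => ij; try ring; rewrite ij; ring.
rewrite !two_rows_cons /tile.
case: (ltnP i j) => ij; case: (ltnP j h) => jh; case: (ltnP i h) => ih;
  try (exfalso; lia); rewrite ?[in RHS](mulrDr, mulrCA (1 + b * x)).
(* With [1 + b * x] distributed over the right-hand side, each summand there has the form to which
   the induction hypothesis applies. *)
all: rewrite -?IH; repeat (case: ifP => ?; try (exfalso; lia)); ring.
Qed.

Definition point t u : K := (u == t)%:R.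

Lemma point_cons h t l : point (h :: t) \o cons l =1 fun u => (l == h)%:R * point t u.
Proof.
by move=> u; rewrite /point /= eqseq_cons; case: (l == h); rewrite ?mul1r ?mul0r.
Qed.

Lemma row_sum_point x h t l i s :
  row_sum x (point (h :: t) \o cons l) i s = (l == h)%:R * row_sum x (point t) i s.
Proof. by rewrite (eq_row_sum _ _ _ (point_cons h t l)) row_sumZ. Qed.

Lemma two_rows_point x y h t l i j s :
  two_rows x y (point (h :: t) \o cons l) i j s = (l == h)%:R * two_rows x y (point t) i j s.
Proof.
by rewrite /two_rows -row_sumZ; apply: eq_row_sum => u; rewrite row_sum_point.
Qed.

(** A cross leaves a strand to the left of one that is not larger, whether or not the two have
    crossed before; an increasing outcome thus comes from elbows only. *)
Lemma row_sum_sorted x r l s : sorted ltn r -> row_sum x (point r) l s = point r (l :: s).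
Proof.
elim: s r l => [|h s IH] [|a r] l //=.
  by move=> _; rewrite !row_sum0 ?mulr0 ?if_same ?addr0.
move=> ar; have sr : sorted ltn r by apply: path_sorted ar.
rewrite !row_sum_point !IH //.
have -> : point (a :: r) [:: l, h & s] = (l == a)%:R * point r (h :: s).
  by rewrite /point eqseq_cons; case: eqP; rewrite ?mul1r ?mul0r.
rewrite -[RHS]addr0; congr (_ + _).
case: ltnP => lh; rewrite /point; case: eqP => [?|_]; rewrite ?mul0r ?mulr0 //;
  case: eqP => [E|_]; rewrite ?mulr0 //; move: ar; subst a; rewrite -E /= => /andP[]; lia.
Qed.

(* The smallest strand runs along its row until it turns up, and the crosses to
   the right of that turn would leave a descent. *)
Lemma row_sum_leading x p i r s : i \notin p -> sorted ltn r -> {in s, forall h, (i < h)%N} ->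
  row_sum x (point (p ++ i :: r)) i s = x ^+ size p * point (p ++ r) s.
Proof.
move=> + sr; elim: s p => [|h s IH] [|a p] /=.
- by rewrite /point eqseq_cons eqxx /= expr0 mul1r eq_sym; case: r {sr}.
- by move=> _ _; rewrite /point eqseq_cons; case: p => [|? ?]; rewrite andbF /= mulr0.
- move=> _ si; rewrite !row_sum_point eqxx si ?mem_head // eq_sym.
  have /negbTE -> : i != h by rewrite neq_ltn si ?mem_head.
  by rewrite !mul0r mulr0 addr0 row_sum_sorted // expr0.
- rewrite inE negb_or => /andP[/negbTE ia ip] si.
  rewrite !row_sum_point ia mul0r add0r si ?mem_head //.
  rewrite IH //; last by move=> l ls; rewrite si // inE ls orbT.
  rewrite /point eqseq_cons exprS; case: (h == a) => /=; last by rewrite mul0r !mulr0.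
  by rewrite mul1r mulrA.
Qed.

Lemma two_rows_map x y phi i j s (f : nat -> nat) :
  {in [:: i, j & s] &, {mono f : k l / (k < l)%N}} ->
  two_rows x y phi (f i) (f j) (map f s) = two_rows x y (phi \o map f) i j s.
Proof.
move=> fm; rewrite /two_rows row_sum_map; last first.
  by apply: sub_in2 fm => k; rewrite !inE => /orP[] ->; rewrite ?orbT.
apply: row_sum_perm => u us /=; apply: row_sum_map; apply: sub_in2 fm => k.
by rewrite !inE (perm_mem us) inE.
Qed.

Lemma two_rows_perm x y phi psi i j s :
  (forall u, perm_eq u [:: i, j & s] -> phi u = psi u) ->
  two_rows x y phi i j s = two_rows x y psi i j s.
Proof.
move=> E; apply: row_sum_perm => u us; apply: row_sum_perm => v vs; apply: E.
by rewrite (perm_trans vs) // perm_cons.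
Qed.

(** Row sums depend only on the order of the labels, and lowering the least label j to i preserves
    that order. *)
Lemma two_rows_relabel x y i j p r s k l : (i < j)%N ->
  {in s ++ p ++ r, forall h, (j < h)%N} -> (j <= k)%N -> (j <= l)%N ->
  let f h := if h == j then i else h in
  two_rows x y (point (p ++ i :: r)) (f k) (f l) s =
  two_rows x y (point (p ++ j :: r)) k l s.
Proof.
move=> ij sj jk jl f.
have f_id u : {in u, forall h, (j < h)%N} -> map f u = u.
  by move=> uj; apply: map_id_in => h /uj jh; rewrite /f gtn_eqF.
have fm : {in [pred h | j <= h]%N &, {mono f : h h' / (h < h')%N}}.
  by move=> h h'; rewrite !inE /f => jh jh'; do 2! case: eqP => ?; lia.
have f_inj : {in [pred h | j <= h]%N &, injective f}.
  by move=> h h'; rewrite !inE /f => jh jh'; do 2! case: eqP => ?; lia.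
have sub (q : seq nat) : {subset q <= s ++ p ++ r} -> {in q, forall h, (j < h)%N}.
  by move=> qs h /qs /sj.
have Ep := f_id _ (sub p _); have Er := f_id _ (sub r _); have Es := f_id _ (sub s _).
rewrite -{1}Es ?two_rows_map; last 2 first.
- by apply: sub_in2 fm => h; rewrite !inE => /or3P[/eqP ->|/eqP ->|hs] //; rewrite ltnW ?sj ?mem_cat ?hs.
- by move=> h hs; rewrite mem_cat hs.
apply: two_rows_perm => u us; rewrite /point /= .
have -> : p ++ i :: r = map f (p ++ j :: r).
  by rewrite map_cat /= Ep ?Er /f ?eqxx // => h hs; rewrite !mem_cat hs ?orbT.
congr (_%:R); congr nat_of_bool; apply/eqP/eqP => [/(inj_in_map f_inj) -> //|-> //].
  apply/allP => h; rewrite (perm_mem us) !inE => /or3P[/eqP ->|/eqP ->|hs] //.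
  by rewrite ltnW ?sj ?mem_cat ?hs.
apply/allP => h; rewrite mem_cat inE => /or3P[hp|/eqP ->|hr]; rewrite inE //.
  by rewrite ltnW ?sj ?mem_cat ?hp ?orbT.
by rewrite ltnW ?sj ?mem_cat ?hr ?orbT.
Qed.

(** Expanding the first column is enough. An outcome starting with i forces an elbow in the upper
    box; one starting with j forces an elbow below and a cross of i and j above. After j is
    relabelled as i, the remaining columns have the same target, and [two_rows_swap] for i and h
    compares them. *)
Lemma two_rows_divided_difference x y i j p r s : (i < j)%N ->
  {in s ++ p ++ r, forall h, (j < h)%N} ->
  (y - x) * two_rows x y (point (i :: p ++ j :: r)) i j s =
  (1 + b * x) * two_rows y x (point (j :: p ++ i :: r)) i j s -
  (1 + b * y) * two_rows x y (point (j :: p ++ i :: r)) i j s.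
Proof.
move=> ij; have ij0 : (i == j) = false by rewrite ltn_eqF.
case: s => [|h s] sj.
  rewrite /two_rows /= ij /point !eqseq_cons !eqxx (eq_sym j i) ij0 /=.
  case: p sj => [|a p] /= sj; rewrite !eqseq_cons ?eqxx /=; last first.
    by case: p sj => [|? ?] sj; rewrite !andbF; ring.
  by case: r sj => [|? ?] sj; rewrite /= ?andbF; ring.
have jh : (j < h)%N by rewrite sj ?mem_head.
have ih := ltn_trans ij jh.
rewrite !two_rows_cons /tile ij jh ih !two_rows_point !eqxx ij0 (eq_sym j i) ij0.
rewrite (gtn_eqF ih) (gtn_eqF jh).
set q := p ++ i :: r; set q' := p ++ j :: r.
have sj' : {in s ++ p ++ r, forall l, (j < l)%N}.
  by move=> l ls; rewrite sj // inE ls orbT.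
have := two_rows_relabel x y ij sj' (leqnn j) (ltnW jh).
rewrite /= eqxx (gtn_eqF jh) -/q -/q' => <-.
have := two_rows_relabel x y ij sj' (ltnW jh) (leqnn j).
rewrite /= eqxx (gtn_eqF jh) -/q -/q' => <-.
have := two_rows_swap x y (point q) i h s; rewrite ih => E.
transitivity (y * ((1 + b * x) * two_rows y x (point q) i h s) -
  (1 + b * y) * (x * two_rows x y (point q) i h s)); last by ring.
by rewrite -E; ring.
Qed.

(** * Grothendieck polynomials, row by row *)

Implicit Types xs : nat -> K.

(** In continuation style: [phi] judges the strands leaving row c at the top, and the last argument
    lists those entering the lowest row from below, of which a triangle has none. *)
Fixpoint rows_sum xs c m phi : seq nat -> K :=
  if m is m'.+1 then rows_sum xs c.+1 m' (row_sum (xs c) phi c) else phi.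

Definition groth xs c m t : K := rows_sum xs c m (point t) [::].

Lemma eq_rows_sum xs c m phi psi : (forall u, perm_eq u (iota c m) -> phi u = psi u) ->
  rows_sum xs c m phi [::] = rows_sum xs c m psi [::].
Proof.
elim: m c phi psi => [|m IH] c phi psi E /=; first exact: E.
apply: IH => u um; apply: row_sum_perm => v vu; apply: E.
by rewrite (perm_trans vu) //= perm_cons.
Qed.

Lemma eq_fun_rows_sum xs c m phi psi u : phi =1 psi ->
  rows_sum xs c m phi u = rows_sum xs c m psi u.
Proof.
elim: m c phi psi u => [|m IH] c phi psi u E /=; first exact: E.
by apply: IH => v; apply: eq_row_sum.
Qed.

Lemma rows_sum_linear xs c m a1 a2 phi psi u :
  rows_sum xs c m (fun v => a1 * phi v + a2 * psi v) u =
  a1 * rows_sum xs c m phi u + a2 * rows_sum xs c m psi u.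
Proof.
elim: m c phi psi u => //= m IH c phi psi u; rewrite -IH.
by apply: eq_fun_rows_sum => v; rewrite row_sumD !row_sumZ.
Qed.

Lemma rows_sum_vars xs xs' c m phi u : (forall i, (c <= i < c + m)%N -> xs i = xs' i) ->
  rows_sum xs c m phi u = rows_sum xs' c m phi u.
Proof.
elim: m c phi => //= m IH c phi E; rewrite (E c) ?leqnn ?addnS ?ltnS ?leq_addr //.
by apply: IH => i /andP[ci im]; rewrite E // (ltnW ci) addnS -addSn.
Qed.

Lemma groth_sorted xs c m : groth xs c m (iota c m) = 1.
Proof.
elim: m c => [|m IH] c; first by [].
rewrite /groth /= -(IH c.+1); apply: eq_rows_sum => u um.
by rewrite row_sum_sorted ?(iota_ltn_sorted c m.+1) // /point eqseq_cons eqxx.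
Qed.

(** The divided difference produces the word c+1, p, c, r, where the smallest strand is followed by
    an increasing tail. By [row_sum_leading] the top row contributes only a power of its variable,
    and strand c disappears. *)
Lemma groth_recursion xs c m p r : {in p ++ r, forall h, (c.+1 < h)%N} -> sorted ltn r ->
  (xs c.+1 - xs c) * groth xs c m.+2 (c :: p ++ c.+1 :: r) =
  (1 + b * xs c) * xs c.+1 ^+ (size p).+1 *
    groth (fun i => if i == c.+1 then xs c else xs i) c.+1 m.+1 (c.+1 :: p ++ r) -
  (1 + b * xs c.+1) * xs c ^+ (size p).+1 * groth xs c.+1 m.+1 (c.+1 :: p ++ r).
Proof.
move=> cpr sr; set xs' := fun i => if _ then _ else _; set x := xs c; set y := xs c.+1.
pose phi := row_sum x (point (c.+1 :: p ++ r)) c.+1.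
pose psi := row_sum y (point (c.+1 :: p ++ r)) c.+1.
have E1 : groth xs' c.+1 m.+1 (c.+1 :: p ++ r) = rows_sum xs c.+2 m phi [::].
  have xs'c : xs' c.+1 = x by rewrite /xs' eqxx.
  rewrite /groth /= xs'c; apply: rows_sum_vars => i /andP[ci _].
  by rewrite /xs' gtn_eqF.
have E2 : groth xs c.+1 m.+1 (c.+1 :: p ++ r) = rows_sum xs c.+2 m psi [::] by [].
rewrite E1 E2 -mulNr -rows_sum_linear.
have E a f : a * rows_sum xs c.+2 m f [::] = rows_sum xs c.+2 m (fun v => a * f v) [::].
  transitivity (rows_sum xs c.+2 m (fun v => a * f v + 0 * f v) [::]).
    by rewrite rows_sum_linear mul0r addr0.
  by apply: eq_fun_rows_sum => v; rewrite mul0r addr0.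
rewrite [LHS]E; apply: eq_rows_sum => u um.
have uc : {in u, forall h, (c.+1 < h)%N}.
  by move=> h; rewrite (perm_mem um) mem_iota => /andP[].
have swap z z' : two_rows z z' (point (c.+1 :: p ++ c :: r)) c c.+1 u =
    z ^+ (size p).+1 * row_sum z' (point (c.+1 :: p ++ r)) c.+1 u.
  rewrite /two_rows -row_sumZ; apply: row_sum_perm => v vu.
  rewrite -[c.+1 :: p ++ c :: r]/((c.+1 :: p) ++ c :: r) row_sum_leading //.
    rewrite inE negb_or neq_ltn leqnn /=; apply/negP => cp.
    by have := cpr c; rewrite mem_cat cp ltnNge leqnSn => /(_ isT).
  move=> h; rewrite (perm_mem vu) inE => /orP[/eqP ->|/uc]; first exact: ltnSn.
  exact: ltn_trans (ltnSn _).
rewrite -[row_sum _ _ c.+1]/(row_sum y (row_sum x (point (c :: p ++ c.+1 :: r)) c) c.+1).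
rewrite -/(two_rows x y (point (c :: p ++ c.+1 :: r)) c c.+1 u).
rewrite two_rows_divided_difference //; last first.
  by move=> h; rewrite mem_cat => /orP[/uc|/cpr].
by rewrite !swap /phi /psi; ring.
Qed.
End Rows.

(** * Sums over pipe dreams *)

(* A row with its crosses given by [bits]; unlike [trace_row], it also returns
   the strand that leaves through the right edge, at the end of the sequence. *)
Fixpoint bit_row (bits : seq bool) (met : seq (nat * nat)) (l : nat) (s : seq nat) :
    seq nat * seq (nat * nat) :=
  if s is h :: s' then
    let: (rout, tout, met') := through_tile (head false bits) met l h in
    let: (out, met'') := bit_row (behead bits) met' rout s' in (tout :: out, met'')
  else ([:: l], met).

(** Invariant of the sweep: the pairs that have met are the inversions of the current front.
    Comparing two adjacent labels therefore replaces the lookup in [met], as in [row_sum]. *)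
Definition front_spec (f : seq nat) (met : seq (nat * nat)) : Prop :=
  uniq f /\ forall i j, ((i, j) \in met) =
    [&& i < j, i \in f, j \in f & index j f < index i f].

Definition excess (met : seq (nat * nat)) : nat := size met - size (undup met).

Lemma excess_cons ij met : excess (ij :: met) = (ij \in met) + excess met.
Proof.
by rewrite /excess /=; case: ifP => _ /=; rewrite ?subSS // subSn ?size_undup.
Qed.

Lemma front_spec_swap pre l h s met : l < h -> front_spec (pre ++ l :: h :: s) met ->
  (l, h) \notin met /\ front_spec (pre ++ h :: l :: s) ((l, h) :: met).
Proof.
move=> lh [uf E].
have perm_f : perm_eq (pre ++ l :: h :: s) (pre ++ h :: l :: s).
  by rewrite perm_cat2l -(cat1s l) -(cat1s h) perm_catCA.
move: (uf); rewrite cat_uniq /= !inE !negb_or => /and3P[_ /and3P[lp hp /hasPn sp] /and3P[/andP[nlh ls] hs _]].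
have lt_lh : index l (pre ++ l :: h :: s) < index h (pre ++ l :: h :: s).
  by rewrite !index_cat (negbTE lp) (negbTE hp) /= eqxx (negbTE nlh); lia.
split; first by rewrite E (ltnNge (index _ _)) (ltnW lt_lh) !andbF.
split=> [|i j]; first by rewrite -(perm_uniq perm_f).
rewrite inE E -!(perm_mem perm_f) xpair_eqE.
case: (boolP (i < j)) => /= ij; last first.
  by rewrite orbF; apply/negbTE; apply: contra ij => /andP[/eqP -> /eqP ->].
case: (boolP (i \in _)) => /= [iF|]; last first.
  by rewrite orbF => iF; apply: contraNF iF => /andP[/eqP -> _]; rewrite mem_cat mem_head orbT.
case: (boolP (j \in _)) => /= [jF|]; last first.
  by rewrite orbF => jF; apply: contraNF jF => /andP[_ /eqP ->]; rewrite mem_cat !inE eqxx !orbT.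
have nij : i != j by rewrite neq_ltn ij.
rewrite !index_cat; case: (boolP (i \in pre)) => ip; case: (boolP (j \in pre)) => jp.
- suff -> : (i == l) = false by [].
  by apply: contraNF lp => /eqP <-.
- have -> : (i == l) = false by apply: contraNF lp => /eqP <-.
  have ai : index i pre < size pre by rewrite index_mem.
  move: (index j (l :: _)) (index j (h :: _)) => A B.
  by rewrite andFb orFb ![_ < index i _]ltnNge !(leq_trans (ltnW ai)) ?leq_addr.
- have -> : (j == h) = false by apply: contraNF hp => /eqP <-.
  have aj : index j pre < size pre by rewrite index_mem.
  move: (index i (l :: _)) (index i (h :: _)) => A B.
  by rewrite andbF orFb !(leq_trans aj) ?leq_addr.
rewrite !ltn_add2l /=; move: (index i s) (index j s) => A B.
by repeat (case: eqP => //= ?); try lia.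
Qed.

Fixpoint bools (m : nat) : seq (seq bool) :=
  if m is m'.+1 then [seq c :: bs | c <- [:: false; true], bs <- bools m'] else [:: [::]].

Lemma mem_bools m bs : (bs \in bools m) = (size bs == m).
Proof.
elim: m bs => [|m IH] bs; first by rewrite inE; case: bs.
apply/allpairsP/idP => [[[c bs'] [_ /=]]|]; first by rewrite IH => /eqP <- ->.
case: bs => // c bs; rewrite eqSS => sz; exists (c, bs); split; rewrite ?IH //.
by case: c.
Qed.

Lemma bools_uniq m : uniq (bools m).
Proof.
elim: m => //= m IH; rewrite cats0 cat_uniq !map_inj_uniq ?IH; try by move=> ? ? [].
by rewrite andbT /=; apply/hasPn => _ /mapP[bs _ ->]; apply/mapP => -[].
Qed.

Lemma through_tile_front cr met l h pre s : front_spec (pre ++ l :: h :: s) met ->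
  through_tile cr met l h =
    if cr then if l < h then (l, h, (l, h) :: met) else (h, l, (h, l) :: met)
    else (h, l, met).
Proof.
move=> F; rewrite /through_tile; case: cr => //; case: (ltnP l h) => lh.
  by have [/negbTE -> _] := front_spec_swap lh F.
have [uf E] := F; move: uf; rewrite cat_uniq /= !inE !negb_or.
move=> /and3P[_ /and3P[lp hp _] /and3P[/andP[nlh _] _ _]].
suff -> : (h, l) \in met by [].
rewrite E !mem_cat !inE !eqxx !orbT ltn_neqAle eq_sym nlh lh /=.
by rewrite !index_cat (negbTE lp) (negbTE hp) /= eqxx (negbTE nlh); lia.
Qed.

Lemma front_spec_dup pre l h s met : h <= l -> front_spec (pre ++ l :: h :: s) met ->
  (h, l) \in met /\ front_spec (pre ++ l :: h :: s) ((h, l) :: met).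
Proof.
move=> lh F; have [uf E] := F; have hm : (h, l) \in met.
  move: uf; rewrite cat_uniq /= !inE !negb_or.
  move=> /and3P[_ /and3P[lp hp _] /and3P[/andP[nlh _] _ _]].
  rewrite E !mem_cat !inE !eqxx !orbT ltn_neqAle eq_sym nlh lh /=.
  by rewrite !index_cat (negbTE lp) (negbTE hp) /= eqxx (negbTE nlh); lia.
by split=> //; split=> // i j; rewrite inE -E; case: eqP => // ->.
Qed.

(** [pre] holds the strands already sent up in this row; keeping them lets the induction speak of
    the whole front. *)
Lemma bit_row_front bits met l s pre : front_spec (pre ++ l :: s) met ->
  let res := bit_row bits met l s in
  [/\ front_spec (pre ++ res.1) res.2, perm_eq res.1 (l :: s) &
    size bits = size s -> size res.2 = size met + count id bits].
Proof.
elim: s bits met l pre => [|h s IH] bits met l pre F.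
  by split=> // /size0nil -> /=; rewrite addn0.
rewrite /= (through_tile_front _ F).
have shift t r met' : front_spec (pre ++ t :: r :: s) met' ->
  perm_eq [:: t, r & s] [:: l, h & s] ->
  forall d, (size bits = (size s).+1 -> size met' = size met + d) ->
  (size bits = (size s).+1 -> count id bits = d + count id (behead bits)) ->
  let res := bit_row (behead bits) met' r s in
  [/\ front_spec (pre ++ t :: res.1) res.2, perm_eq (t :: res.1) (l :: h :: s) &
    size bits = (size s).+1 -> size res.2 = size met + count id bits].
  rewrite -cat_rcons => /(IH (behead bits)) [F' P' S'] P d Sm Sb res.
  split; first by rewrite -cat_rcons.
    by apply: perm_trans P; rewrite perm_cons.
  by move=> sb; rewrite S' ?size_behead ?sb // Sm // Sb // addnA.
have cons_count c : head false bits = c -> size bits = (size s).+1 ->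
    count id bits = c + count id (behead bits).
  by case: (bits) => //= a bs ->.
case Ec: (head false bits) (cons_count _ erefl) => cc.
  case: (ltnP l h) => lh.
    have [_ F'] := front_spec_swap lh F.
    have := shift _ _ _ F' _ 1 _ cc; case: (bit_row _ _ _ _) => o m' /=; apply.
      by rewrite -(cat1s h) -(cat1s l) perm_catCA.
    by rewrite addn1.
  have [_ F'] := front_spec_dup lh F.
  have := shift _ _ _ F' _ 1 _ cc; case: (bit_row _ _ _ _) => o m' /=; apply => //.
  by rewrite addn1.
have := shift _ _ _ F _ 0 _ cc; case: (bit_row _ _ _ _) => o m' /=; apply => //.
by rewrite addn0.
Qed.

Lemma front_spec_cons c s met : {in s, forall h, c < h} -> front_spec s met ->
  front_spec (c :: s) met.
Proof.
move=> cs [us E]; have nc : c \notin s by apply/negP => /cs; rewrite ltnn.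
split=> [|i j]; first by rewrite /= nc.
rewrite E !inE /=; case: (eqVneq i c) => [->|ic].
  by rewrite (negbTE nc) ltn0 !andbF.
case: (eqVneq j c) => [->|jc] /=; last by rewrite ltnS.
rewrite (negbTE nc) !andbF; apply/esym/negbTE.
by apply/negP => /and3P[ic' /cs]; rewrite ltnNge (ltnW ic').
Qed.

Fixpoint run_rows (c : nat) (cfg : seq (seq bool)) : seq nat * seq (nat * nat) :=
  if cfg is bits :: cfg' then
    let st := run_rows c.+1 cfg' in bit_row bits st.2 c st.1
  else ([::], [::]).

(** Staircases of bits: a row has as many boxes as strands reach it from below, hence none in the
    lowest row. *)
Fixpoint configs (m : nat) : seq (seq (seq bool)) :=
  if m is m'.+1 then [seq bs :: cfg | cfg <- configs m', bs <- bools m'] else [:: [::]].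

Definition num_crosses (cfg : seq (seq bool)) : nat := sumn (map (count id) cfg).

Lemma run_rows_front c m cfg : cfg \in configs m ->
  let st := run_rows c cfg in
  [/\ front_spec st.1 st.2, perm_eq st.1 (iota c m) & size st.2 = num_crosses cfg].
Proof.
elim: m c cfg => [|m IH] c cfg; first by rewrite inE => /eqP ->; split=> //=; split=> // i j; rewrite !in_nil andbF.
move=> /allpairsP[[cfg' bs] /= [Hc Hb ->]] /=.
have [F P S] := IH c.+1 _ Hc; set st := run_rows _ _ in F P S *.
have cs : {in st.1, forall h, c < h}.
  by move=> h; rewrite (perm_mem P) mem_iota => /andP[].
have [F' P' S'] := bit_row_front (pre := [::]) bs (front_spec_cons cs F).
split=> //; first by rewrite (perm_trans P') //= perm_cons.
rewrite S' ?S; first by rewrite addnC.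
by move: Hb; rewrite mem_bools => /eqP ->; rewrite (perm_size P) size_iota.
Qed.

Section ConfigSum.

Local Open Scope ring_scope.

Variables (K : comNzRingType) (b : K).

Lemma bit_row_sum x phi met l s pre : front_spec (pre ++ l :: s) met ->
  \sum_(bs <- bools (size s))
    x ^+ count id bs * b ^+ excess (bit_row bs met l s).2 * phi (bit_row bs met l s).1 =
  b ^+ excess met * row_sum b x phi l s.
Proof.
elim: s met l pre phi => [|h s IH] met l pre phi F.
  by rewrite big_seq1 /= expr0 mul1r.
rewrite -[bools _]/[seq c :: bs | c <- [:: false; true], bs <- bools (size s)].
have step c bs : bit_row (c :: bs) met l (h :: s) =
    let: (r, t, m) := if c then if (l < h)%N then (l, h, (l, h) :: met)
      else (h, l, (h, l) :: met) else (h, l, met) in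
    let: (out, m') := bit_row bs m r s in (t :: out, m').
  by rewrite -(through_tile_front c F).
rewrite big_allpairs_dep big_cons big_seq1.
have shift t r met' : front_spec (pre ++ t :: r :: s) met' -> forall a,
  \sum_(bs <- bools (size s)) a * x ^+ count id bs *
     b ^+ excess (let: (out, m) := bit_row bs met' r s in (t :: out, m)).2 *
     phi (let: (out, m) := bit_row bs met' r s in (t :: out, m)).1 =
  a * b ^+ excess met' * row_sum b x (phi \o cons t) r s.
  rewrite -cat_rcons => F' a; rewrite -mulrA -(IH _ _ _ (phi \o cons t) F') mulr_sumr.
  by apply: eq_bigr => bs _; case: (bit_row _ _ _ _) => o m /=; rewrite -!mulrA.
rewrite -[row_sum b x phi l (h :: s)]/(row_sum b x (phi \o cons l) h s +
  (if (l < h)%N then x * row_sum b x (phi \o cons h) l s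
   else b * x * row_sum b x (phi \o cons l) h s)).
rewrite mulrDr; congr (_ + _); under eq_bigr => bs _ do rewrite step /=.
  have := shift _ _ _ F 1; rewrite mul1r => <-.
  by apply: eq_bigr => bs _; rewrite mul1r.
case: (ltnP l h) => lh.
  have [nm F'] := front_spec_swap lh F.
  transitivity (x * b ^+ excess ((l, h) :: met) * row_sum b x (phi \o cons h) l s).
    by rewrite -(shift _ _ _ F'); apply: eq_bigr => bs _; rewrite exprD expr1.
  by rewrite excess_cons (negbTE nm) /=; ring.
have [nm F'] := front_spec_dup lh F.
transitivity (x * b ^+ excess ((h, l) :: met) * row_sum b x (phi \o cons l) h s).
  by rewrite -(shift _ _ _ F'); apply: eq_bigr => bs _; rewrite exprD expr1.
by rewrite excess_cons nm exprD expr1; ring.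
Qed.

Fixpoint config_weight (xs : nat -> K) (c : nat) (cfg : seq (seq bool)) : K :=
  if cfg is bits :: cfg' then xs c ^+ count id bits * config_weight xs c.+1 cfg' else 1.

Lemma configs_sum xs c m phi :
  \sum_(cfg <- configs m)
    config_weight xs c cfg * b ^+ excess (run_rows c cfg).2 * phi (run_rows c cfg).1 =
  rows_sum b xs c m phi [::].
Proof.
elim: m c phi => [|m IH] c phi; first by rewrite big_seq1 /= !mul1r.
rewrite [RHS]/= -IH [LHS]big_allpairs_dep; apply: eq_big_seq => cfg Hc.
have [F P S] := run_rows_front c.+1 Hc; set st := run_rows _ _ in F P S *.
have cs : {in st.1, forall h, (c < h)%N}.
  by move=> h; rewrite (perm_mem P) mem_iota => /andP[].
rewrite -mulrA -(bit_row_sum _ _ (pre := [::]) (front_spec_cons cs F)).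
rewrite (perm_size P) size_iota mulr_sumr; apply: eq_bigr => bs _ /=; ring.
Qed.

End ConfigSum.

(** A cross of two strands that have met behaves as an elbow. Replacing it by one changes neither
    the strands nor the set of met pairs, only the repetitions in the list. *)
Lemma reduce_bit_row bits met met2 l s : uniq met2 -> met2 =i met ->
  exists2 bits2, size bits2 = size s &
    let res := bit_row bits met l s in let res2 := bit_row bits2 met2 l s in
    [/\ res2.1 = res.1, uniq res2.2 & res2.2 =i res.2].
Proof.
elim: s bits met met2 l => [|h s IH] bits met met2 l um E; first by exists [::].
pose c := head false bits; pose ij := (minn l h, maxn l h).
pose c2 := c && (ij \notin met).
have [r [t [met' [met2' [Et [Et2 [um' E']]]]]]] : exists r t met' met2',
    [/\ through_tile c met l h = (r, t, met'),
    through_tile c2 met2 l h = (r, t, met2'), uniq met2' & met2' =i met'].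
  rewrite /through_tile -/ij E /c2; clear c2; case: c => /=; last by exists h, l, met, met2.
  case: (boolP (ij \in met)) => [im|nim] /=.
    exists h, l, (ij :: met), met2; split=> // e.
    by rewrite inE E; case: eqP => // ->.
  exists l, h, (ij :: met), (ij :: met2); split=> //=.
    by rewrite E nim.
  by move=> e; rewrite !inE E.
have [bits2 sz H] := IH (behead bits) met' met2' r um' E'.
exists (c2 :: bits2); rewrite /= ?sz // -/c Et Et2.
move: H; case: (bit_row bits2 _ _ _) => o2 m2; case: (bit_row _ _ _ _) => o m /=.
by case=> -> um2 Em; split.
Qed.

Lemma reduce_rows c m cfg : cfg \in configs m -> exists2 cfg2, cfg2 \in configs m &
  let st := run_rows c cfg in let st2 := run_rows c cfg2 in
  [/\ st2.1 = st.1, uniq st2.2 & st2.2 =i st.2].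
Proof.
elim: m c cfg => [|m IH] c cfg; first by rewrite inE => /eqP ->; exists [::]; rewrite ?inE.
move=> /allpairsP[[cfg' bs] /= [Hc Hb ->]].
have [cfg2 Hc2 /= [E1 um E2]] := IH c.+1 _ Hc.
have [bs2 sz [F1 F2 F3]] := reduce_bit_row bs c (run_rows c.+1 cfg').1 um E2.
have [_ P _] := run_rows_front c.+1 Hc.
exists (bs2 :: cfg2); last by rewrite /= E1.
apply/allpairsP; exists (cfg2, bs2); split=> //=.
by rewrite mem_bools sz (perm_size P) size_iota.
Qed.

Lemma mem_configs m cfg : (cfg \in configs m) = (map size cfg == rev (iota 0 m)).
Proof.
elim: m cfg => [|m IH] cfg; first by rewrite inE; case: cfg.
rewrite -(addn1 m) iotaD add0n rev_cat addn1 /=.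
apply/allpairsP/idP => [[[cfg' bs] /= [Hc Hb ->]]|].
  by move: Hc Hb; rewrite IH mem_bools /= eqseq_cons => -> /eqP ->; rewrite eqxx.
case: cfg => // bs cfg; rewrite eqseq_cons => /andP[sb sc].
by exists (cfg, bs); rewrite IH mem_bools.
Qed.

Lemma configs_uniq m : uniq (configs m).
Proof.
elim: m => //= m IH; apply: allpairs_uniq => //; first exact: bools_uniq.
by move=> [c1 b1] [c2 b2] _ _ /= [-> ->].
Qed.

(** Beyond the triangle there are only elbows: the strand leaving the triangle turns up in the
    column of d0, each dummy moves one column to the right, and the last one leaves the grid. *)
Lemma trace_row_bits cross a k met l s d0 d :
  (forall j, k + size s <= j -> cross a j = false) ->
  trace_row cross a k met l (s ++ d0 :: d) =
  let: (out, met') := bit_row [seq cross a j | j <- iota k (size s)] met l s in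
  (out ++ belast d0 d, met').
Proof.
elim: s k met l => [|h s IH] k met l Hc; last first.
  rewrite /=; case: (through_tile _ _ _ _) => [[r t] m]; rewrite IH; last first.
    by move=> j; rewrite addSnnS; exact: Hc.
  by case: (bit_row _ _ _ _).
rewrite addn0 in Hc; rewrite /=.
elim: d k l d0 Hc => [|d1 d IH] k l d0 Hc /=; rewrite Hc //=.
by have /= := IH k.+1 d0 d1 (fun j kj => Hc j (ltnW kj)); case: (through_tile _ _ _ _) => [[r t] m] -> .
Qed.

(** * Pipe dreams as staircases of bits *)

Section Encoding.

Variable n : nat.
Implicit Types (P Q : {set box n}).

Lemma encode_shape (F : nat -> nat -> bool) c m : c + m = n.+1 ->
  map size [seq [seq F a b | b <- iota 1 (n - a)] | a <- iota c m] = rev (iota 0 m).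
Proof.
move=> cm; rewrite -map_comp.
apply: (@eq_from_nth _ 0) => [|i]; rewrite size_map ?size_rev !size_iota // => hi.
rewrite (nth_map 0) ?size_iota // nth_rev ?size_iota // !nth_iota /= ?size_map ?size_iota; lia.
Qed.

Definition encode P : seq (seq bool) :=
  [seq [seq is_cross P a b | b <- iota 1 (n - a)] | a <- iota 1 n].

Lemma is_crossE P (x : box n) : is_cross P x.1.+1 x.2.+1 = (x \in P).
Proof.
apply/existsP/idP => [[y /and3P[yP /eqP[e1] /eqP[e2]]]|xP]; last by exists x; rewrite xP !eqxx.
by rewrite (_ : x = y) //; case: x y e1 e2 {yP} => [x1 x2] [y1 y2] /= /val_inj -> /val_inj ->.
Qed.

Lemma is_cross_triangle P a b : P \subset triangle n -> is_cross P a b -> a + b <= n.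
Proof.
move=> /subsetP PT /existsP[x /and3P[/PT xP /eqP <- /eqP <-]].
by move: xP; rewrite inE.
Qed.

Lemma belast_iota x k : belast x (iota x.+1 k) = iota x k.
Proof. by elim: k x => //= k IH x; rewrite IH. Qed.

Lemma trace_encode P : P \subset triangle n -> trace P = run_rows 1 (encode P).
Proof.
move=> PT; rewrite /trace foldl_rev.
(* After the m lowest rows the front consists of m genuine strands followed by the first n - m
   dummies. *)
suff H m c : 0 < c -> c + m = n.+1 ->
    foldr (fun a st => trace_row (is_cross P) a 1 st.2 a st.1) (iota n.+1 n, [::]) (iota c m) =
    let st := run_rows c [seq [seq is_cross P a b | b <- iota 1 (n - a)] | a <- iota c m] in
    (st.1 ++ iota n.+1 (n - m), st.2).
  by rewrite H // subnn /= cats0; case: run_rows.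
elim: m c => [|m IH] c c0 cm /=; first by rewrite subn0.
have mn : m < n by lia.
rewrite IH // ?addSnnS //; set cfg := map _ _.
have Hcfg : cfg \in configs m.
  by rewrite mem_configs encode_shape // addSnnS.
have [_ /perm_size] := run_rows_front c.+1 Hcfg; rewrite size_iota => sz _.
set st := run_rows _ _ in sz *.
have -> : iota n.+1 (n - m) = n.+1 :: iota n.+2 (n - m.+1) by have -> : n - m = (n - m.+1).+1 by lia.
rewrite trace_row_bits sz; last first.
  move=> j mj; apply/negbTE/negP => /(is_cross_triangle PT); lia.
have -> : n - c = m by lia.
by case: (bit_row _ _ _ _) => o m' /=; rewrite belast_iota.
Qed.

Definition decode (cfg : seq (seq bool)) : {set box n} :=
  [set x : box n | nth false (nth [::] cfg x.1) x.2].

Lemma nth_encode P (x : box n) : x \in triangle n ->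
  nth false (nth [::] (encode P) x.1) x.2 = (x \in P).
Proof.
rewrite inE => xt; have h1 : x.1 < n by lia. have h2 : x.2 < n - x.1.+1 by lia.
rewrite (nth_map 0) ?size_iota // nth_iota //.
by rewrite (nth_map 0) ?size_iota // nth_iota // !add1n is_crossE.
Qed.

Lemma encodeK P : P \subset triangle n -> decode (encode P) = P.
Proof.
move=> /subsetP PT; apply/setP => x; rewrite inE.
case: (boolP (x \in triangle n)) => [/nth_encode -> //|xt].
rewrite (contraNF (@PT x) xt) //; move: xt; rewrite inE -ltnNge => xt.
rewrite (nth_map 0) ?size_iota ?(leq_trans (ltn_ord _)) ?leq_pred //.
by rewrite nth_default // size_map nth_iota ?size_iota; have := ltn_ord x.1; lia.
Qed.

Lemma encode_configs P : encode P \in configs n.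
Proof.
by rewrite mem_configs encode_shape.
Qed.

Lemma configs_size cfg i : cfg \in configs n -> i < n ->
  size cfg = n /\ size (nth [::] cfg i) = n - i.+1.
Proof.
rewrite mem_configs => /eqP E hi.
have sz : size cfg = n by rewrite -(size_map size) E size_rev size_iota.
split=> //; rewrite -(nth_map _ 0) ?sz // E nth_rev ?size_iota // nth_iota; lia.
Qed.

Lemma decodeK cfg : cfg \in configs n -> encode (decode cfg) = cfg /\ decode cfg \subset triangle n.
Proof.
move=> Hc; split; last first.
  apply/subsetP => x; rewrite !inE => nx; have := ltn_ord x.1 => h1.
  have [_ sz] := configs_size Hc (leq_trans h1 (leq_pred n)).
  by case: (ltnP x.2 (n - x.1.+1)) => [|le]; [lia|rewrite nth_default ?sz in nx].
have sz : size cfg = n.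
  by move: Hc; rewrite mem_configs => /eqP /(congr1 size); rewrite size_map size_rev size_iota.
apply: (@eq_from_nth _ [::]) => [|i]; rewrite size_map size_iota ?sz // => hi.
have [_ szi] := configs_size Hc hi.
rewrite (nth_map 0) ?size_iota // nth_iota // add1n.
apply: (@eq_from_nth _ false) => [|j]; rewrite size_map size_iota ?szi // => hj.
rewrite (nth_map 0) ?size_iota // nth_iota // add1n.
have hi' : i < n.-1 by lia.
have hj' : j < n.-1 by lia.
by rewrite (is_crossE (decode cfg) (Ordinal hi', Ordinal hj')) inE.
Qed.

Lemma perm_encode :
  perm_eq [seq encode P | P <- enum (powerset (triangle n))] (configs n).
Proof.
apply: uniq_perm; [|exact: configs_uniq|].
  rewrite map_inj_in_uniq ?enum_uniq // => P Q; rewrite !mem_enum !powersetE => PT QT E.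
  by rewrite -(encodeK PT) E encodeK.
move=> cfg; apply/mapP/idP => [[P _ ->]|Hc]; first exact: encode_configs.
have [E T] := decodeK Hc; exists (decode cfg); last by rewrite E.
by rewrite mem_enum powersetE.
Qed.

Lemma config_weight_encode (K : comNzRingType) (xs : nat -> K) P : P \subset triangle n ->
  config_weight xs 1 (encode P) = (\prod_(x in P) xs x.1.+1)%R.
Proof.
move=> PT.
have -> : config_weight xs 1 (encode P) =
    (\prod_(a <- iota 1 n) xs a ^+ count (is_cross P a) (iota 1 (n - a)))%R.
  suff gen m c : config_weight xs c [seq [seq is_cross P a b | b <- iota 1 (n - a)] | a <- iota c m] =
      (\prod_(a <- iota c m) xs a ^+ count (is_cross P a) (iota 1 (n - a)))%R by exact: gen.
  elim: m c => [|m IH] c /=; first by rewrite big_nil.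
  by rewrite big_cons IH count_map.
have -> : (\prod_(x in P) xs x.1.+1 = \prod_(i < n.-1) xs i.+1 ^+ #|[pred j | (i, j) \in P]|)%R.
  transitivity (\prod_(i < n.-1) \prod_(j < n.-1 | (i, j) \in P) xs i.+1)%R.
    by rewrite pair_big_dep /=; apply: eq_bigl => -[i j].
  by apply: eq_bigr => i _; rewrite prodr_const.
have -> : (\prod_(a <- iota 1 n) xs a ^+ count (is_cross P a) (iota 1 (n - a)) =
    \prod_(a <- iota 1 n.-1) xs a ^+ count (is_cross P a) (iota 1 n.-1))%R.
  case: (posnP n) => [n0|n0].
    have [e1 e2] : iota 1 n = [::] /\ iota 1 n.-1 = [::] by rewrite n0; split.
    by rewrite e1 e2 !big_nil.
  have -> : iota 1 n = iota 1 n.-1 ++ [:: n].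
    by rewrite -[in LHS](prednK n0) -[n.-1.+1]addn1 iotaD /= add1n prednK.
  rewrite big_cat /= big_seq1 subnn expr0 mulr1; apply: eq_big_seq => a.
  rewrite mem_iota => ha; congr (_ ^+ _)%R.
  have -> : n.-1 = n - a + a.-1 by lia.
  rewrite iotaD count_cat -[LHS]addn0; congr (_ + _); apply/esym/eqP.
  rewrite -leqn0 leqNgt -has_count; apply/hasPn => j; rewrite mem_iota => hj.
  apply/negP => /(is_cross_triangle PT); lia.
rewrite (iotaDl 1 0) big_map -val_enum_ord big_map big_enum /=.
apply: eq_bigr => i _; congr (_ ^+ _)%R.
rewrite !count_map cardE /enum_mem size_filter.
by rewrite -enumT; apply: eq_count => j /=; rewrite !add1n (is_crossE P (i, j)).
Qed.


(** Weighting every cross by the indeterminate turns the count into a comparison of degrees. *)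
Lemma num_crosses_encode P : P \subset triangle n -> num_crosses (encode P) = #|P|.
Proof.
move=> PT; have := config_weight_encode (fun=> 'X : {poly rat})%R PT.
have -> cfg c : config_weight (fun=> 'X : {poly rat})%R c cfg = ('X ^+ num_crosses cfg)%R.
  elim: cfg c => [|bs cfg IH] c /=; first by rewrite expr0.
  by rewrite IH -exprD.
rewrite prodr_const => /(congr1 (fun p : {poly rat} => size p)).
by rewrite !size_polyXn => -[].
Qed.

Variable w : 'S_n.

(** All pipe dreams of w have the same set of met pairs, the inversions of w. Reduced ones have one
    cross per inversion, so every facet has the same size, and [reduce_rows] provides a facet. *)
Lemma codim_excess P : P \in Pipes w ->
  codim (PD w) (elbows P) = excess (trace P).2.
Proof.
rewrite inE => /andP[PT /eqP trP]; pose ell := size (undup (trace P).2).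
have trE Q : Q \in Pipes w -> size (trace Q).2 = #|Q| /\ size (undup (trace Q).2) = ell.
  rewrite inE => /andP[QT /eqP trQ].
  have [[_ FQ] _ SQ] := run_rows_front 1 (encode_configs Q).
  have [[_ FP] _ _] := run_rows_front 1 (encode_configs P).
  rewrite -!trace_encode // in SQ FQ FP.
  split; first by rewrite SQ num_crosses_encode.
  apply/perm_size/uniq_perm; rewrite ?undup_uniq // => -[i j].
  by rewrite !mem_undup FP FQ trP trQ.
have elb Q : Q \subset triangle n -> #|elbows Q| = #|triangle n| - #|Q|.
  by move=> QT; rewrite /elbows cardsD (setIidPr QT).
have PP : P \in Pipes w by rewrite inE PT trP eqxx.
have [szP _] := trE P PP.
rewrite /codim; have -> : \max_(G in PD w) #|G| = #|triangle n| - ell.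
  apply/eqP; rewrite eqn_leq; apply/andP; split.
    apply/bigmax_leqP => G; rewrite inE => /existsP[Q /andP[QP /andP[rQ GQ]]].
    rewrite (leq_trans (subset_leq_card GQ)) // elb.
      by have [<- <-] := trE Q QP; rewrite undup_id.
    by move: QP; rewrite inE => /andP[].
  have [cfg Hc [E um _]] := reduce_rows 1 (encode_configs P).
  have [Ec Tc] := decodeK Hc; pose Q := decode cfg.
  have QP : Q \in Pipes w.
    by rewrite inE Tc /= trace_encode // Ec E -trace_encode // trP.
  have rQ : reduced Q by rewrite /reduced trace_encode // Ec.
  have [szQ ellQ] := trE Q QP.
  have -> : #|triangle n| - ell = #|elbows Q| by rewrite elb // -szQ -ellQ undup_id.
  by apply: (@leq_bigmax_cond _ _ (fun G : {set box n} => #|G|)); rewrite inE; apply/existsP; exists Q; rewrite QP rQ /=.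
rewrite /excess elb // -/ell szP.
have leP : #|P| <= #|triangle n| by apply: subset_leq_card.
have leE : ell <= #|P| by rewrite -szP size_undup.
lia.
Qed.

Lemma eval_Grothendieck (K : comNzRingType) (phi : {rmorphism {poly rat} -> K}) (xs : nat -> K) :
  mmap phi (fun i : 'I_n.-1 => xs i.+1) (Grothendieck w) =
  groth (phi beta) xs 1 n (oneline w).
Proof.
rewrite /groth -configs_sum -(perm_big _ perm_encode) big_map /=.
have -> : (\sum_(P <- enum (powerset (triangle n)))
   config_weight xs 1 (encode P) * phi beta ^+ excess (run_rows 1 (encode P)).2 *
     point K (oneline w) (run_rows 1 (encode P)).1 =
  \sum_(P in Pipes w) phi beta ^+ excess (trace P).2 * \prod_(x in P) xs x.1.+1)%R.
  rewrite big_enum /= (bigID (fun P => P \in Pipes w)) /= [X in (_ + X)%R]big1 ?addr0.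
    apply: eq_big => [P|P /andP[]].
      by rewrite powersetE inE andbA andbb.
    rewrite powersetE inE => PT /andP[_ /eqP E].
    by rewrite config_weight_encode // -trace_encode // /point E eqxx mulr1 mulrC.
  move=> P /andP[]; rewrite powersetE inE => PT; rewrite PT /= => /negbTE E.
  by rewrite -trace_encode // /point E mulr0.
rewrite /Grothendieck raddf_sum /=; apply: eq_bigr => P PP.
rewrite rmorphM /= mmapC /= rmorphXn /= codim_excess //; congr (_ * _)%R.
by rewrite rmorph_prod; apply: eq_bigr => x _ /=; rewrite mmapX mmap1U.
Qed.

End Encoding.

(** * The polynomial of a tree *)

Section TreePolynomial.

Local Open Scope ring_scope.

Variable n : nat.
Local Notation R := {poly rat}.
Local Notation P := {mpoly R[n]}.
Implicit Types (f g : P) (i j k l : 'I_n).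

(* Opaque, so that unification never unfolds the substitution. *)
Lemma msubst_sig i j : {F : {rmorphism P -> P} | (forall c, F c%:MP = c%:MP) &
  forall k, F 'X_k = if k == j then 'X_i else 'X_k}.
Proof.
exists (comp_mpoly [tuple if k == j then 'X_i else 'X_k | k < n]) => [c|k] /=.
  exact: comp_mpolyC.
by rewrite comp_mpolyXU -tnth_nth tnth_mktuple.
Qed.

Definition msubst i j : {rmorphism P -> P} := s2val (msubst_sig i j).

Lemma msubstC i j c : msubst i j c%:MP = c%:MP.
Proof. by rewrite /msubst; case: msubst_sig. Qed.

Lemma msubstX i j k : msubst i j 'X_k = if k == j then 'X_i else 'X_k.
Proof. by rewrite /msubst; case: msubst_sig. Qed.

Lemma eq_rmorphism_mpoly (S : nzRingType) (F G : {rmorphism P -> S}) :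
  (forall c, F c%:MP = G c%:MP) -> (forall i, F 'X_i = G 'X_i) -> F =1 G.
Proof.
move=> eqC eqX; elim/mpolyind=> [|c m p _ _ IH]; first by rewrite !rmorph0.
rewrite !rmorphD IH -mul_mpolyC !rmorphM /= eqC; congr (_ * _ + _).
by rewrite mpolyXE_id !rmorph_prod; apply: eq_bigr => i _; rewrite !rmorphXn eqX.
Qed.

Lemma msubst_comp i j k l f i' j' k' l' :
  (forall h, msubst i j (msubst k l 'X_h) = msubst i' j' (msubst k' l' 'X_h)) ->
  msubst i j (msubst k l f) = msubst i' j' (msubst k' l' f).
Proof.
move=> eqX; pose F : {rmorphism P -> P} := msubst i j \o msubst k l.
pose G : {rmorphism P -> P} := msubst i' j' \o msubst k' l'.
have CC a b c d u : msubst a b (msubst c d u%:MP) = u%:MP by rewrite !msubstC.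
apply: (@eq_rmorphism_mpoly _ F G) => [c|h]; last exact: eqX.
by transitivity (c%:MP : P); [exact: CC|exact/esym/CC].
Qed.

Lemma msubst_id i f : msubst i i f = f.
Proof.
apply: (@eq_rmorphism_mpoly _ (msubst i i) idfun) => [c|k]; first exact: msubstC.
by rewrite msubstX; case: eqP => [->|].
Qed.

Lemma msubst_over i j k f : i != k -> msubst j k (msubst i k f) = msubst i k f.
Proof.
move=> ik; rewrite -[RHS](msubst_id i); apply: msubst_comp => h.
rewrite (msubst_id i) (msubstX i k h); case: (eqVneq h k) => [_|hk]; rewrite msubstX.
  by rewrite (negbTE ik).
by rewrite (negbTE hk).
Qed.

Lemma msubst_move i j a l f : l != i -> l != j -> a != l ->
  msubst i j (msubst a l f) = msubst (if a == j then i else a) l (msubst i j f).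
Proof.
move=> li lj al; apply: msubst_comp => h.
rewrite (msubstX a l h) (msubstX i j h).
case: (eqVneq h l) => [->|hl]; first by rewrite (negbTE lj) !msubstX eqxx; case: (a == j).
rewrite msubstX; case: (eqVneq h j) => [_|_]; rewrite msubstX.
  by rewrite eq_sym (negbTE li).
by rewrite (negbTE hl).
Qed.

(** The boolean equality lets [xchoose] extract the quotient. *)
Lemma msubst_divides i j f : exists g, f - msubst i j f == ('X_j - 'X_i) * g.
Proof.
suff [g ->] : exists g, f - msubst i j f = ('X_j - 'X_i) * g by exists g.
elim/mpolyind: f => [|c m p _ _ [g Hg]]; first by exists 0; rewrite rmorph0; ring.
have [h Hh] : exists h, 'X_[m] - msubst i j 'X_[m] = ('X_j - 'X_i) * h.
  rewrite mpolyXE_id.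
  apply: (big_ind (fun f => exists h, f - msubst i j f = ('X_j - 'X_i) * h)).
  - by exists 0; rewrite rmorph1; ring.
  - move=> x y [hx Hx] [hy Hy]; exists (hx * y + msubst i j x * hy).
    by rewrite rmorphM mulrDr mulrA -Hx mulrCA -Hy; ring.
  - move=> k _; elim: (m k) => [|d [h Hh]]; first by exists 0; rewrite expr0 rmorph1; ring.
    exists ((k == j)%:R * 'X_k ^+ d + msubst i j 'X_k * h).
    rewrite exprS rmorphM mulrDr (mulrCA _ (msubst i j 'X_k) h) -Hh msubstX.
    by case: eqP => [->|_] /=; ring.
exists (c%:MP * h + g); rewrite -mul_mpolyC rmorphD rmorphM /= msubstC.
by rewrite mulrDr -Hg mulrCA -Hh; ring.
Qed.

Definition mquot i j f : P := xchoose (msubst_divides i j f).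

(** Division-free form of the operator, from (t_j + b) f - (t_i + b) f' = (t_j - t_i) f + (t_i + b)
    (f - f') with f' the value of f at t_j = t_i. *)
Definition dedge i j f : P := 'X_i * (f + ('X_i + beta%:MP) * mquot i j f).

Lemma dedgeE i j f : ('X_j - 'X_i) * dedge i j f =
  'X_i * (('X_j + beta%:MP) * f - ('X_i + beta%:MP) * msubst i j f).
Proof.
have /eqP Q := xchooseP (msubst_divides i j f).
rewrite /dedge; move: (mquot i j f) (Q : _ = _ * mquot i j f) => q {}Q.
have -> : msubst i j f = f - ('X_j - 'X_i) * q by rewrite -Q; ring.
by ring.
Qed.

Lemma mpolyX_sub_neq0 i j : i != j -> 'X_j - 'X_i != 0 :> P.
Proof.
move=> ij; rewrite subr_eq0; apply/eqP => /(congr1 (fun p : P => p@_U_(i)%MM)).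
rewrite !mcoeffX eqxx; case: eqP => [E|_ /eqP]; last by rewrite eq_sym oner_eq0.
by move: (congr1 (fun m : 'X_{1..n} => m i) E); rewrite !mnmE eqxx eq_sym (negbTE ij).
Qed.

Variables (K : fieldType) (phi : {rmorphism R -> K}).
Implicit Type e : nat -> K.

Definition eval_at e : {rmorphism P -> K} := mmap phi (fun i : 'I_n => e i).

Definition update e (j : nat) (u : K) : nat -> K := 
  fun h : nat => if h == j then u else e h.

Lemma eval_atX e i : eval_at e 'X_i = e i.
Proof. by rewrite /eval_at /= mmapX mmap1U. Qed.

Lemma eval_atC e c : eval_at e c%:MP = phi c.
Proof. by rewrite /eval_at /= mmapC. Qed.

Lemma eval_at_msubst e i j f :
  eval_at e (msubst i j f) = eval_at (update e j (e i)) f.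
Proof.
pose F : {rmorphism P -> K} := eval_at e \o msubst i j.
apply: (@eq_rmorphism_mpoly _ F (eval_at (update e j (e i)))) => [c|k].
  by rewrite eval_atC -[LHS]/(eval_at e (msubst i j c%:MP)) msubstC eval_atC.
rewrite eval_atX -[LHS]/(eval_at e (msubst i j 'X_k)) msubstX /update.
by rewrite -val_eqE; case: ifP => _; rewrite eval_atX.
Qed.

Definition tree_eval (T : seq (nat * nat)) e : K := eval_at e (tree_poly dedge T).

Lemma tree_eval_nil e : tree_eval [::] e = 1.
Proof. exact: rmorph1. Qed.

Lemma tree_eval_cons (i j : nat) T e : (i < n)%N -> (j < n)%N -> e i != e j ->
  tree_eval ((i, j) :: T) e = e i / (e j - e i) *
   ((e j + phi beta) * tree_eval T e -
    (e i + phi beta) * tree_eval T (update e j (e i))).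
Proof.
move=> hi hj eij; rewrite /tree_eval /=.
rewrite (insubT (fun i : nat => (i < n)%N) hi) (insubT (fun i : nat => (i < n)%N) hj) /=.
set i' := Sub i hi; set j' := Sub j hj; set f := tree_poly _ _.
have := congr1 (eval_at e) (dedgeE i' j' f).
rewrite !(rmorphM, rmorphB, rmorphD) eval_at_msubst !eval_atX !eval_atC /= => E.
have nz : e j - e i != 0 by rewrite subr_eq0 eq_sym.
by apply: (mulfI nz); rewrite E; field.
Qed.

Lemma tree_eval_reduced_form T p e : all (fun e : nat * nat => e.1 < e.2 < n)%N T ->
  pairwise (fun e e' : nat * nat => e.1 != e'.2) T ->
  reduced_form (tree_monom T) p ->
  monalg.mmap phi (source_monom e) p = tree_eval T e.
Proof.
move=> aT pT Tp; pose x i : P := 'X_i.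
have DE i j f : (x j - x i) * dedge i j f =
  x i * ((x j + beta%:MP) * f - (x i + beta%:MP) * msubst i j f) := dedgeE i j f.
have red := @reduced_form_truncation P n beta%:MP x msubst dedge
  (fun i j => msubstC i j beta) msubstX msubst_over msubst_move mpolyX_sub_neq0
  DE K phi (eval_at e) e (eval_atC e beta) (eval_atX e) _ _ Tp.
rewrite red; last first.
  move=> [u v]; rewrite tree_monomE -has_count has_pred1 => /(allP aT); exact.
by rewrite (@truncation_tree P n beta%:MP x msubst dedge
  (fun i j => msubstC i j beta) msubstX msubst_over msubst_move mpolyX_sub_neq0 DE T).
Qed.

End TreePolynomial.

(** Converts the counts that define rows and columns of the region back into inequalities. *)
Lemma count_down (p : pred nat) a m k :
  (forall i j, a <= i -> i < j -> j < a + m -> p j -> p i) ->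
  a <= k < a + m -> p k = (k < a + count p (iota a m)).
Proof.
elim: m a => [|m IH] a down /andP[ak km]; first by move: km; rewrite addn0 ltnNge ak.
rewrite /=; case: (boolP (p a)) => [pa|npa].
  rewrite addnA addn1; case: (ltngtP a k) ak => // [lt_ak|<-] _; last by rewrite pa leq_addr.
  apply: IH => [i j ai ij|]; last by rewrite lt_ak addSnnS.
  by rewrite addSnnS; apply: down ij => //; exact: ltnW.
have no j : a <= j < a + m.+1 -> p j = false.
  case: (ltngtP a j) => // [aj /= jm|<- _]; last exact: negbTE.
  by apply/negbTE; apply: contra npa; exact: down.
rewrite no ?ak // (@eq_in_count _ _ pred0) ?count_pred0 => [|j]; last first.
  by rewrite mem_iota => /andP[aj jm]; apply: no; rewrite (ltnW aj) addnS -addSn.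
by rewrite !addn0 ltnNge ak.
Qed.

(** * Dominant permutations *)

Section Dominant.

Variables (n : nat) (pi : 'S_n).
Hypotheses (n_gt1 : 1 < n) (dom : one_dominant pi).

Definition word : seq nat := oneline (pi^-1)%g.

Lemma size_word : size word = n.
Proof. by rewrite size_map -cardE card_ord. Qed.

Lemma nth_word (i : 'I_n) : nth 0 word i = ((pi^-1)%g i).+1.
Proof. by rewrite (nth_map i) ?size_enum_ord // nth_ord_enum. Qed.

Lemma word_perm : perm_eq word (iota 1 n).
Proof.
apply: uniq_perm; rewrite ?iota_uniq //.
  by rewrite map_inj_uniq ?enum_uniq // => i j [] E; apply/(@perm_inj _ (pi^-1)%g)/val_inj.
move=> x; rewrite mem_iota; apply/mapP/andP => [[i _ ->]|[x0 xn]]; first by split=> //; rewrite add1n ltnS; exact: ltn_ord.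
have x1 : x.-1 < n by lia.
by exists (pi (Ordinal x1)); rewrite ?mem_enum // permK /=; lia.
Qed.

Lemma word_uniq : uniq word.
Proof. by rewrite (perm_uniq word_perm) iota_uniq. Qed.

Lemma mem_word x : (x \in word) = (1 <= x <= n).
Proof. by rewrite (perm_mem word_perm) mem_iota. Qed.

Lemma index_word (i : 'I_n) : index (i.+1) word = pi i.
Proof.
have <- : nth 0 word (pi i) = i.+1 by rewrite nth_word permK.
by rewrite index_uniq ?word_uniq ?size_word.
Qed.

Lemma oneline_nth (i : 'I_n) : nth 0 (oneline pi) i = (pi i).+1.
Proof. by rewrite (nth_map i) ?size_enum_ord // nth_ord_enum. Qed.

Lemma nth0_word : nth 0 word 0 = 1.
Proof.
have n0 : 0 < n by lia.
have [hd _] := dom; have p0 : pi (Ordinal n0) = Ordinal n0.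
  by apply/val_inj; move: hd; rewrite -nth0 (oneline_nth (Ordinal n0)) => -[].
by rewrite (nth_word (Ordinal n0)) -[in LHS]p0 permK.
Qed.

(** The pattern 132 is its own inverse, so a forbidden triple of [word] is, with positions and
    values exchanged, a forbidden triple of [pi]. Since the letter 1 stands at position 0, such a
    triple avoids the leading entry of [pi]. *)
Lemma word_avoids a b d : 1 <= a -> a < b -> b < d -> d < n ->
  ~~ (nth 0 word a < nth 0 word d < nth 0 word b).
Proof.
move=> a1 ab bd dn; have bn := ltn_trans bd dn; have an := ltn_trans ab bn.
rewrite (nth_word (Ordinal an)) (nth_word (Ordinal dn)) (nth_word (Ordinal bn)) !ltnS.
set x := (pi^-1)%g _; set y := (pi^-1)%g _; set z := (pi^-1)%g _.
apply/negP => /andP[xy yz]; have [_ av] := dom.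
have x0 : 0 < x.
  rewrite lt0n; apply/eqP => x0; have := nth0_word.
  have n0 : 0 < n by lia.
  rewrite (nth_word (Ordinal n0)) => /succn_inj E.
  have : (pi^-1)%g (Ordinal n0) = x by apply/val_inj; exact: (etrans E (esym x0)).
  by move/perm_inj => /(congr1 val) /= E'; rewrite -E' in a1.
have sz : size (behead (oneline pi)) = n.-1.
  by rewrite size_behead size_map size_enum_ord.
have zn := ltn_ord z.
have h1 : x.-1 < y.-1 by lia.
have h2 : y.-1 < z.-1 by lia.
have h3 : z.-1 < size (behead (oneline pi)) by rewrite sz; lia.
have := av _ _ _ h1 h2 h3; rewrite !nth_behead.
have -> : x.-1.+1 = x by lia.
have -> : y.-1.+1 = y by lia.
have -> : z.-1.+1 = z by lia.
by rewrite !oneline_nth !permKV /= !ltnS ab bd.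
Qed.

Lemma diagramE r c : diagram pi r c =
  [&& 0 < r, 1 <= c <= n, r.-1 < index c word & c < nth 0 word r.-1].
Proof.
apply/existsP/and4P => [[i /existsP[j /and4P[ij pij /eqP-> /eqP->]]]|].
  by split=> //=; rewrite ?index_word ?ltn_ord // nth_word permK ltnS.
move=> [r0 /andP[c0 cn]]; case: r r0 => // r _; case: c c0 cn => // c _ cn /=.
rewrite (index_word (Ordinal cn)) => rc.
have rn : r < n := ltn_trans rc (ltn_ord _).
rewrite (nth_word (Ordinal rn)) ltnS => cr.
exists (Ordinal cn); apply/existsP; exists ((pi^-1)%g (Ordinal rn)).
by rewrite permKV rc cr !eqxx.
Qed.

(** The number of boxes in column c+1 of the diagram, which is also column c of the bottom pipe
    dream. *)
Definition mu (c : nat) : nat :=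
  count (fun k => c.+1 < nth 0 word k) (iota 0 (index c.+1 word)).

Lemma index_word_lt c : 1 < c -> c <= n -> 0 < index c word < n.
Proof.
move=> c1 cn; have cw : c \in word by rewrite mem_word cn (ltnW c1).
have -> : index c word < n by rewrite -[X in _ < X]size_word index_mem.
rewrite andbT lt0n; apply/eqP => E.
by have := nth_index 0 cw; rewrite E nth0_word => E'; rewrite -E' in c1.
Qed.

(** Before the letter c, a smaller letter at a positive position cannot precede a larger one, for
    with c they would form a 132. The larger letters thus fill the positions right after the leading
    1. *)
Lemma word_above c k : 1 < c -> c <= n -> k < index c word ->
  (c < nth 0 word k) = (0 < k <= mu c.-1).
Proof.
move=> c1 cn kc; have /andP[i0 iN] := index_word_lt c1 cn.
rewrite /mu prednK ?(ltnW c1) //; case: k kc => [|k] kc /=.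
  by rewrite nth0_word; lia.
have nc1 : (c < nth 0 word 0) = false by rewrite nth0_word; lia.
rewrite -(prednK i0) /= nc1 add0n.
rewrite (@count_down (fun k => c < nth 0 word k) 1 (index c word).-1) ?add1n //; last first.
  by rewrite prednK.
move=> i j i1 ij; rewrite prednK // => jc; apply: contraTT => nci.
have ic := ltn_trans ij jc; have in' := ltn_trans ic iN; have := word_avoids i1 ij jc iN.
rewrite nth_index ?mem_word ?cn ?(ltnW c1) //.
have -> : nth 0 word i < c.
  rewrite ltn_neqAle leqNgt nci andbT; apply/eqP => E.
  by move: ic; rewrite -E index_uniq ?word_uniq ?size_word ?ltnn.
by [].
Qed.

Lemma mu0 : mu 0 = 0.
Proof. by rewrite /mu -nth0_word index_uniq ?word_uniq ?size_word // ltnW. Qed.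

Lemma mu_out c : n <= c -> mu c = 0.
Proof.
move=> nc; rewrite /mu (@eq_in_count _ _ pred0) ?count_pred0 // => k.
rewrite mem_iota memNindex ?size_word => [/andP[_ kn] /=|]; last by rewrite mem_word; lia.
have : nth 0 word k \in word by rewrite mem_nth ?size_word.
by rewrite mem_word => kw; apply/negbTE; lia.
Qed.

Lemma mu_lt c : 1 < c -> c <= n -> mu c.-1 < index c word.
Proof.
move=> c1 cn; have /andP[i0 _] := index_word_lt c1 cn.
have nc1 : (c < nth 0 word 0) = false by rewrite nth0_word; lia.
rewrite /mu prednK ?(ltnW c1) // -(prednK i0) /= nc1 add0n ltnS.
by rewrite (leq_trans (count_size _ _)) // size_iota.
Qed.

(** * Diagram and region of a dominant permutation *)

Lemma diagram_dominant r c :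
  diagram pi r c = [&& 1 < c, c <= n, 1 < r & r <= (mu c.-1).+1].
Proof.
rewrite diagramE; case: r => [|r] /=; first by rewrite !andbF.
case: (ltngtP 1 c) => [c1|c0|<-] /=; first last.
- by rewrite -nth0_word index_uniq ?word_uniq ?size_word // ?andbF // ltnW.
- by case: c c0.
rewrite ?(ltnW c1) /=; case: (leqP c n) => //= cn; rewrite !ltnS.
case: (ltnP r (index c word)) => [rc|cr] /=; first exact: word_above.
by have := mu_lt c1 cn => muc; apply/esym/negbTE; lia.
Qed.



(** Otherwise position [mu c + 1] carries a letter above c+2 and lies before c+2. If it precedes c+1
    it would be counted by [mu c]; if it follows c+1, then c+1, this letter and c+2 form a 132. *)
Lemma mu_leq c : 0 < c -> mu c.+1 <= mu c.
Proof.
move=> c0; case: (leqP c.+2 n) => [cn|nc]; last by rewrite mu_out // -ltnS.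
have c1n : c.+1 <= n := ltnW cn.
rewrite leqNgt; apply/negP => lt_mu; set k := (mu c).+1.
have kC : k < index c.+2 word by apply: leq_ltn_trans (mu_lt (c := c.+2) isT cn).
have /andP[_ iN] := index_word_lt (c := c.+2) isT cn.
have /andP[i0 _] := index_word_lt (c := c.+1) c0 c1n.
have bk : c.+2 < nth 0 word k by rewrite word_above.
case: (ltngtP k (index c.+1 word)) => [kc|ck|E].
- by have := word_above (c := c.+1) c0 c1n kc; rewrite (ltnW bk) ltnn andbF.
- have := word_avoids i0 ck kC iN; rewrite !nth_index ?mem_word ?cn ?c1n //.
  by rewrite bk ltnSn.
- by move: bk; rewrite E nth_index ?mem_word ?c1n // ltnNge leqnSn.
Qed.

Lemma mu_anti c d : 0 < c -> c <= d -> mu d <= mu c.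
Proof.
move=> c0 /subnK <-; elim: (d - c) => // k IH; rewrite addSn.
by apply: leq_trans IH; apply: mu_leq; rewrite addn_gt0 c0 orbT.
Qed.

Lemma bottomE r c : bottom pi r c = [&& 0 < c, 1 < r & r <= (mu c).+1].
Proof.
rewrite /bottom; case: (ltnP 1 r) => r1 /=; last first.
  rewrite (@eq_count _ _ pred0) ?count_pred0 => [|d]; first by case: c.
  by rewrite diagram_dominant; apply/negbTE; lia.
case: (posnP c) => //= c0; have -> : iota 1 n = 1 :: iota 2 n.-1.
  by rewrite -[in LHS](prednK (ltnW n_gt1)).
rewrite /= diagram_dominant /= add0n.
case: (ltnP c n) => [cn|nc].
  set k := count _ _; have -> : (c <= k) = (c.+1 < 2 + k) by [].
  rewrite /k -(@count_down (diagram pi r) 2 n.-1 c.+1); last by lia.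
    by rewrite diagram_dominant /=; lia.
  move=> i j i2 ij; rewrite !diagram_dominant => _ /and4P[j1 jn -> rj].
  rewrite i2 (leq_trans (ltnW ij) jn) (leq_trans rj) // ltnS; apply: mu_anti; lia.
rewrite mu_out //; move: (count_size (diagram pi r) (iota 2 n.-1)); rewrite size_iota.
by move: (count _ _) => k kn; lia.
Qed.

Lemma topE r c : top pi r c = [&& 0 < c, 0 < r & r <= mu c.-1].
Proof.
rewrite /top; have -> : count (diagram pi ^~ c) (iota 1 n) = (0 < c) * mu c.-1; last first.
  by case: (posnP c) => [->|c0]; rewrite ?mul1n //= leqNgt; case: r.
case: (ltnP 1 c) => [c1|]; last first.
  move=> c1; rewrite (@eq_count _ _ pred0) ?count_pred0 => [|d].
    by case: c c1 => [|[]] //; rewrite mu0.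
  by rewrite diagram_dominant; apply/negbTE; lia.
rewrite (ltnW c1) mul1n; case: (leqP c n) => cn; last first.
  rewrite mu_out ?(@eq_count _ _ pred0) ?count_pred0 //; last by lia.
  by move=> d; rewrite diagram_dominant; apply/negbTE; lia.
have /andP[_ iN] := index_word_lt c1 cn; have ml := mu_lt c1 cn.
rewrite (@eq_count _ _ (fun r => 2 <= r <= (mu c.-1).+1)); last first.
  by move=> d; rewrite diagram_dominant c1 cn.
have -> : iota 1 n = iota 1 (1 + mu c.-1 + (n - (mu c.-1).+1)) by congr (iota 1 _); lia.
rewrite !iotaD !count_cat /= add0n -[RHS]addn0; congr (_ + _).
  rewrite -[RHS](size_iota 2) -count_predT; apply: eq_in_count => d.
  by rewrite mem_iota /=; lia.
rewrite (@eq_in_count _ _ pred0) ?count_pred0 // => d; rewrite mem_iota /=; lia.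
Qed.

(** The bottom pipe dream fills rows 2 to [mu c + 1] of column c, and the top one rows 1 to
    [mu c.-1]; in column 1 the box (1,1) supplies the first row. *)
Definition height (c : nat) : nat :=
  if (c == 1) || (0 < mu c.-1) then maxn (mu c).+1 (mu c.-1) else 0.

Lemma regionE r c : region pi r c = [&& 0 < c, 0 < r & r <= height c].
Proof.
rewrite /region /core bottomE topE xpair_eqE /height.
case: c => [|[|c]]; first by rewrite /= andbF.
  by rewrite /= mu0 maxn0; lia.
rewrite /= andbF orbF /=; have := @mu_leq c.+1 isT.
by case: ifP => h; have := h; lia.
Qed.

Lemma count_leq m h : h <= m -> count (fun r => r <= h) (iota 1 m) = h.
Proof.
move=> hm; rewrite -(subnKC hm) iotaD count_cat.
rewrite (@eq_in_count _ _ predT) ?count_predT ?size_iota; last by move=> r; rewrite mem_iota /=; lia.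
rewrite (@eq_in_count _ _ pred0) ?count_pred0 ?addn0 // => r; rewrite mem_iota /=; lia.
Qed.

Lemma mu_ltn c : mu c < n.
Proof.
case: (posnP c) => [->|c0]; first by rewrite mu0; lia.
case: (ltnP c n) => [cn|nc]; last by rewrite mu_out //; lia.
have := mu_lt (c := c.+1) c0 cn; have /andP[_] := index_word_lt (c := c.+1) c0 cn.
by move=> h1 h2; exact: ltn_trans h2 h1.
Qed.

Lemma height_leq c : height c <= n.
Proof. by rewrite /height; case: ifP => // _; rewrite geq_max mu_ltn ltnW ?mu_ltn. Qed.

Lemma col_lengthE c : 0 < c -> col_length pi c = height c.
Proof.
move=> c0; rewrite /col_length -[RHS](count_leq (height_leq c)).
by apply: eq_in_count => r; rewrite mem_iota regionE c0 => /andP[-> _].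
Qed.

Lemma height_anti c d : 0 < c -> c <= d -> height d <= height c.
Proof.
move=> c0; rewrite leq_eqVlt => /predU1P[-> //|cd]; rewrite /height.
have m1 := @mu_anti c d c0 (ltnW cd); have m2 : mu d.-1 <= mu c by apply: mu_anti; lia.
have m3 : (c == 1) || (mu c <= mu c.-1).
  by case: c c0 {cd m1 m2} => [|[|c]] //= _; exact: mu_leq.
by move: m3; case: eqP => //= c1; do ?case: ifP; lia.
Qed.

Lemma row_lengthE r c : 0 < r -> 0 < c <= n -> (c <= row_length pi r) = (r <= height c).
Proof.
move=> r0 /andP[c0 cn]; rewrite /row_length; set k := count _ _.
have -> : (c <= k) = (c < 1 + k) by [].
rewrite /k -(@count_down (region pi r) 1 n c) ?c0 ?cn //.
  by rewrite regionE c0 r0.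
move=> i j i1 ij _; rewrite !regionE i1 r0 => /and3P[_ _ /leq_trans]; apply.
by apply: height_anti => //; exact: ltnW.
Qed.

(** The shape required by [groth_recursion]. The tail r increases because a descent among the larger
    letters after c+1 would form a 132 with it. *)
Lemma word_split c : 0 < c -> c < n -> exists p r,
  [/\ [seq x <- word | c < x] = p ++ c.+1 :: r, [seq x <- word | c.+1 < x] = p ++ r,
    size p = mu c & sorted ltn r].
Proof.
move=> c0 cn; set C := c.+1; have Cw : C \in word by rewrite mem_word.
have /andP[i0 iN] := index_word_lt (c := C) c0 cn.
set idx := index C word in i0 iN; pose A := take idx word; pose B := drop idx.+1 word.
have wE : word = A ++ C :: B.
  by rewrite -[LHS](cat_take_drop idx) (drop_nth 0) ?size_word // nth_index.
have := word_uniq; rewrite wE cat_uniq /= negb_or => /and3P[_ /andP[CA _] /andP[CB _]].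
have gtE s : C \notin s -> [seq x <- s | c < x] = [seq x <- s | C < x].
  move=> Cs; apply: eq_in_filter => x xs; rewrite ltn_neqAle [C < x]ltn_neqAle.
  by case: (eqVneq C x) => [Cx|_]; [move: Cs; rewrite Cx xs|lia].
exists [seq x <- A | C < x], [seq x <- B | C < x]; split.
- by rewrite filter_cat /= ltnSn !gtE.
- by rewrite filter_cat /= ltnn.
- rewrite size_filter /mu -/C -/idx /A -(map_nth_iota0 0) ?size_word ?(ltnW iN) //.
  by rewrite count_map.
have pB : pairwise (fun x y => (C < x) && (C < y) ==> (x < y)) B.
  apply/(pairwiseP 0) => i j; rewrite !inE !size_drop size_word !nth_drop => hi hj ij.
  apply/implyP => /andP[xi xj]; rewrite ltn_neqAle nth_uniq ?word_uniq ?size_word; try lia.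
  rewrite leqNgt eqn_add2l neq_ltn ij /=; apply/negP => yx.
  have h1 : idx < idx.+1 + i by lia.
  have h2 : idx.+1 + i < idx.+1 + j by lia.
  have h3 : idx.+1 + j < n by lia.
  by have := word_avoids i0 h1 h2 h3; rewrite nth_index // xj yx.
rewrite sorted_pairwise; last exact: ltn_trans.
have: pairwise (fun x y => (C < x) && (C < y) ==> (x < y)) [seq x <- B | C < x].
  by apply: subseq_pairwise pB; exact: filter_subseq.
apply: sub_in_pairwise (filter_all _ _) => x y Cx Cy.
by rewrite (Cx : C < x) (Cy : C < y).
Qed.



Lemma mu_pred : mu n.-1 = 0.
Proof.
rewrite /mu prednK ?(ltnW n_gt1) // (@eq_in_count _ _ pred0) ?count_pred0 // => k.
rewrite mem_iota => /andP[_ kn]; have kn' : k < n.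
  by rewrite (leq_trans kn) // -[X in _ <= X]size_word index_size.
have : nth 0 word k \in word by rewrite mem_nth ?size_word.
by rewrite mem_word => kw; apply/negbTE; lia.
Qed.

Lemma height_n : height n = 0.
Proof. by rewrite /height mu_pred ltnn orbF gtn_eqF. Qed.

Local Notation width := (row_length pi 1).

Lemma leq_width c : 0 < c <= n -> (c <= width) = (0 < height c).
Proof. exact: row_lengthE. Qed.

Lemma width_ltn : width < n.
Proof.
have : width <= n by rewrite (leq_trans (count_size _ _)) // size_iota.
have := @leq_width n; rewrite height_n ltnn; lia.
Qed.

Lemma width_gt0 : 0 < width.
Proof. by rewrite leq_width ?(ltnW n_gt1) // /height /= leq_max. Qed.

Lemma mu_gt0 c : 0 < c < width -> 0 < mu c.
Proof.
have wn := width_ltn; move=> cw; have := @leq_width c.+1.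
rewrite /height; case: c cw => [|c] cw //=; case: ifP => //; lia.
Qed.

Lemma mu_width : mu width = 0.
Proof.
have wn := width_ltn; have w0 := width_gt0; have := @leq_width width.+1.
rewrite /height ltnn /= wn => /(_ isT); case: (posnP (mu _)) => [-> //|h].
by rewrite orbT leq_max.
Qed.

Lemma heightE c : 0 < c <= width -> height c = maxn (mu c).+1 (mu c.-1).
Proof.
move=> /andP[c0 cw]; rewrite /height; case: eqP => //= c1.
by rewrite mu_gt0 //; lia.
Qed.

(** * The southeast boundary and the vertex labels *)

Definition block (c : nat) : seq (nat + nat) :=
  inl c :: [seq inr r | r <- rev (iota (height c.+1).+1 (height c - height c.+1))].

Definition blocks a m : seq (nat + nat) := flatten [seq block c | c <- iota a m].

Lemma boundaryE : boundary pi = blocks 1 width.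
Proof.
congr flatten; apply/eq_in_map => c; rewrite mem_iota => /andP[c0 _].
by rewrite !col_lengthE.
Qed.

Lemma blocks_cat a m1 m2 : blocks a (m1 + m2) = blocks a m1 ++ blocks (a + m1) m2.
Proof. by rewrite /blocks iotaD map_cat flatten_cat. Qed.

Lemma boundary_split c : 0 < c <= width ->
  boundary pi = blocks 1 c.-1 ++ block c ++ blocks c.+1 (width - c).
Proof.
move=> cw; rewrite boundaryE.
transitivity (blocks 1 (c.-1 + (1 + (width - c)))); first by congr blocks; lia.
rewrite !blocks_cat add1n prednK; last by lia.
by rewrite addn1 /blocks /= cats0.
Qed.

Lemma inl_block d c : (inl d \in block c) = (d == c).
Proof.
rewrite inE; have -> : (inl d == inl c :> nat + nat) = (d == c) by [].
by rewrite (introF mapP) ?orbF // => -[].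
Qed.

Lemma inr_block r c : (inr r \in block c) = (height c.+1 < r <= height c).
Proof.
by rewrite inE /= mem_map ?mem_rev ?mem_iota => [|? ? []//]; lia.
Qed.

Lemma notin_blocks s m : (forall c, 0 < c <= m -> s \notin block c) -> s \notin blocks 1 m.
Proof.
move=> H; apply/flattenP => -[_ /mapP[c cm ->]]; apply/negP/H.
by move: cm; rewrite mem_iota.
Qed.

Definition pos c : nat := size (blocks 1 c.-1).

Lemma index_inl c : 0 < c <= width -> index (inl c) (boundary pi) = pos c.
Proof.
move=> cw; rewrite (boundary_split cw) index_cat ifN; last first.
  by apply: notin_blocks => d dc; rewrite inl_block; lia.
by rewrite /= eqxx addn0.
Qed.

Lemma index_inr c r : 0 < c <= width -> height c.+1 < r <= height c ->
  index (inr r) (boundary pi) = (pos c + (height c - r)).+1.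
Proof.
move=> cw rc; rewrite (boundary_split cw) index_cat ifN; last first.
  apply: notin_blocks => d dc; rewrite inr_block.
  have : height c <= height d.+1 by apply: height_anti; lia.
  lia.
rewrite index_cat ifT ?inr_block // /= addnS; congr (_ + _).+1.
rewrite index_map => [|? ? []//].
have uR := iota_uniq (height c.+1).+1 (height c - height c.+1).
have <- : nth 0 (rev (iota (height c.+1).+1 (height c - height c.+1))) (height c - r) = r.
  by rewrite nth_rev size_iota ?nth_iota; lia.
rewrite index_uniq ?rev_uniq ?size_rev ?size_iota //; last by lia.
by rewrite nth_rev size_iota ?nth_iota; lia.
Qed.

Lemma posS c : 0 < c -> pos c.+1 = (pos c + (height c - height c.+1)).+1.
Proof.
move=> c0; rewrite /pos /= -[in LHS](prednK c0) -[c.-1.+1]addn1 blocks_cat size_cat add1n prednK //.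
by rewrite /blocks /= cats0 size_map size_rev size_iota addnS.
Qed.

Lemma pos_ltn c d : 0 < c -> c < d -> pos c + (height c - height c.+1) < pos d.
Proof.
move=> c0; elim: d => // d IH; rewrite ltnS leq_eqVlt => /predU1P[<-|cd].
  by rewrite posS.
by rewrite (ltn_trans (IH cd)) // posS ?ltnS ?leq_addr //; lia.
Qed.

Lemma row_column r : 0 < r <= height 1 -> exists2 c, 0 < c <= width & height c.+1 < r <= height c.
Proof.
move=> /andP[r0 r1]; exists (row_length pi r).
  have h : 0 < row_length pi r <= n.
    by rewrite row_lengthE ?r1 ?(ltnW n_gt1) // (leq_trans (count_size _ _)) // size_iota.
  have := row_lengthE r0 h; rewrite leqnn => /esym hr; have /andP[-> _] := h.
  by rewrite leq_width // (leq_trans r0).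
have h : 0 < row_length pi r <= n.
  by rewrite row_lengthE ?r1 ?(ltnW n_gt1) // (leq_trans (count_size _ _)) // size_iota.
have := row_lengthE r0 h; rewrite leqnn => /esym hr; rewrite hr andbT.
case: (ltnP (row_length pi r) n) => rn.
  by have := @row_lengthE r (row_length pi r).+1 r0; rewrite rn ltnn => /(_ isT); rewrite ltnNge => <-.
have E : row_length pi r = n by apply/eqP; rewrite eqn_leq rn andbT; case/andP: h.
by move: hr; rewrite E height_n leqNgt r0.
Qed.

Local Notation lab := (label pi).

Lemma label_lt s s' : index s (boundary pi) < index s' (boundary pi) ->
  in_A_at pi (index s' (boundary pi)) -> lab s < lab s'.
Proof.
move=> lt_s A; rewrite /label -(subnKC lt_s) -addnS iotaD count_cat -[X in X < _]addn0 ltn_add2l.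
by rewrite -has_count; apply/hasP; exists (index s' (boundary pi)) => //; rewrite mem_iota; lia.
Qed.

Lemma in_A_inr c r : 0 < c <= width -> height c.+1 < r <= height c ->
  in_A_at pi (index (inr r) (boundary pi)).
Proof.
move=> cw rc; rewrite /in_A_at nth_index // (boundary_split cw) !mem_cat inr_block rc.
by rewrite orbT.
Qed.

(** If [mu c = mu c.-1], the E step bounds the bottom pipe dream and any preceding N step lies too
    low to do so. If [mu c] is smaller, then [height c = mu c.-1]: either the E step does not bound
    it, or the N step just before it, in row [mu c.-1 + 1], does. *)
Lemma in_A_inl c : 0 < c <= width ->
  in_A_at pi (index (inl c) (boundary pi)) = (c == 1) || (mu c == mu c.-1).
Proof.
move=> cw; have in_b : inl c \in boundary pi.
  by rewrite (boundary_split cw) !mem_cat inl_block eqxx orbT.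
rewrite /in_A_at nth_index // index_inl // (boundary_split cw) take_size_cat //.
case: c cw in_b => [|[|c]] // cw _; rewrite -[c.+2.-1]/(c.+1) -[c.+2 == 1]/false orFb.
rewrite -[c.+1]addn1 blocks_cat /blocks /= cats0 add1n addn1 /nilp size_cat addnS /=.
rewrite bottomE col_lengthE //.
have cw1 : 0 < c.+1 <= width by lia.
have h1 := heightE cw; have h2 := heightE cw1; have m1 := @mu_leq c.+1 isT; have m0 := @mu_gt0 c.+1.
have m2 : mu c.+1 <= mu c \/ c = 0 by case: (c) => [|c']; [right|left; exact: mu_leq].
rewrite last_cat /=.
case E : (height c.+1 - height c.+2) => [|d] /=.
  rewrite andbT; move: h1 h2 E => /= -> ->; lia.
rewrite rev_cons map_rcons last_rcons /= bottomE.
have -> : row_length pi (height c.+2).+1 = c.+1.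
  apply/eqP; rewrite eqn_leq; have wn := width_ltn.
  have a := @row_lengthE (height c.+2).+1 c.+1 isT; have b := @row_lengthE (height c.+2).+1 c.+2 isT.
  lia.
by move: h1 h2 E => /= -> ->; lia.
Qed.

Lemma label_inl_inr c d r : 0 < c <= d -> d <= width -> mu d < r <= height d ->
  lab (inl c) < lab (inr r).
Proof.
move=> cd dw rd; have d1 : 0 < r <= height 1.
  by have := @height_anti 1 d; lia.
have [k kw rk] := row_column d1; have dk : d <= k.
  by rewrite leqNgt; apply/negP => kd; have := @height_anti k.+1 d; lia.
apply: label_lt; last exact: in_A_inr kw rk.
rewrite index_inl ?(index_inr kw rk); last by lia.
rewrite ltnS; have : pos c <= pos k; last by lia.
have : c <= k by lia.
rewrite leq_eqVlt => /predU1P[-> //|ck]; have := @pos_ltn c k; lia.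
Qed.

(** The E step is outside A and directly follows the N step of row [height c + 1], and here
    [height c = mu c.-1]. *)
Lemma label_descent c : 1 < c <= width -> mu c < mu c.-1 ->
  lab (inl c) = lab (inr (mu c.-1).+1).
Proof.
case: c => [|[|c]] // cw; rewrite -[c.+2.-1]/(c.+1) => mc.
have cw1 : 0 < c.+1 <= width by lia.
have cw2 : 0 < c.+2 <= width by lia.
have h1 := heightE cw2; have h2 := heightE cw1; rewrite /= in h1 h2.
have rk : height c.+2 < (mu c.+1).+1 <= height c.+1 by lia.
rewrite /label (index_inr cw1 rk) index_inl // posS //.
have -> : height c.+1 - (mu c.+1).+1 = (height c.+1 - height c.+2).-1 by lia.
have -> : (pos c.+1 + (height c.+1 - height c.+2)).+1 =
   (pos c.+1 + (height c.+1 - height c.+2).-1).+2 by lia.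
set m := (pos c.+1 + _).+1; rewrite -[m.+2]addn1 iotaD count_cat /= addn0 add0n.
have -> : m.+1 = index (inl c.+2) (boundary pi) by rewrite index_inl // posS /m; lia.
by rewrite in_A_inl //= ltn_eqF ?addn0 // index_inl // posS /m; congr count; congr iota; lia.
Qed.

Lemma label_inl_lt c d : 0 < c < d -> d <= width -> lab (inl c) < lab (inl d).
Proof.
move=> cd dw; have d0 : 0 < d <= width by lia.
case: (boolP (in_A_at pi (index (inl d) (boundary pi)))) => [A|].
  apply: label_lt => //; rewrite !index_inl; try lia.
  by have := @pos_ltn c d; lia.
rewrite in_A_inl // negb_or => /andP[d1 md].
have m : mu d < mu d.-1.
  by rewrite ltn_neqAle md; case: (d) d1 cd => [|[|d']] //= _ _; exact: mu_leq.
have d1' : 1 < d <= width by lia.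
rewrite (label_descent d1' m); apply: (@label_inl_inr c d.-1); try lia.
have dw' : 0 < d.-1 <= width by lia.
have := heightE d0; have := heightE dw'; lia.
Qed.

Lemma label_inr_inj r r' : 0 < r <= height 1 -> 0 < r' <= height 1 ->
  lab (inr r) = lab (inr r') -> r = r'.
Proof.
move=> r1 r1' E; have [k kw rk] := row_column r1; have [k' kw' rk'] := row_column r1'.
case: (ltngtP (index (inr r) (boundary pi)) (index (inr r') (boundary pi))) => [lt|lt|eq].
- by have := label_lt lt (in_A_inr kw' rk'); rewrite E ltnn.
- by have := label_lt lt (in_A_inr kw rk); rewrite E ltnn.
have in_b : inr r \in boundary pi by rewrite (boundary_split kw) !mem_cat inr_block rk orbT.
have in_b' : inr r' \in boundary pi by rewrite (boundary_split kw') !mem_cat inr_block rk' orbT.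
by have := nth_index (inl 0) in_b; rewrite eq nth_index // => -[].
Qed.

(** Tells sinks from sources: an N step shares its vertex with an E step only at a descent of [mu],
    since every step of A raises the label. *)
Lemma label_inr_inl c r : 0 < c <= width -> 0 < r <= height 1 ->
  lab (inr r) = lab (inl c) -> [/\ 1 < c, mu c < mu c.-1 & r = (mu c.-1).+1].
Proof.
move=> cw r1 E; have [k kw rk] := row_column r1.
have Ar := in_A_inr kw rk.
have lt_rc : index (inr r) (boundary pi) < index (inl c) (boundary pi).
  case: ltngtP => // [lt|eq]; first by have := label_lt lt Ar; rewrite E ltnn.
  have in_b : inr r \in boundary pi by rewrite (boundary_split kw) !mem_cat inr_block rk orbT.
  have in_b' : inl c \in boundary pi by rewrite (boundary_split cw) !mem_cat inl_block eqxx orbT.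
  by have := nth_index (inl 0) in_b; rewrite eq nth_index.
case: (boolP (in_A_at pi (index (inl c) (boundary pi)))) => [A|].
  by have := label_lt lt_rc A; rewrite E ltnn.
rewrite in_A_inl // negb_or => /andP[c1 mc].
have m : mu c < mu c.-1.
  by rewrite ltn_neqAle mc; case: (c) c1 cw => [|[|c']] //= _ _; exact: mu_leq.
split=> //; first by lia.
have cw1 : 0 < c.-1 <= width by lia.
have h1 := heightE cw; have h2 := heightE cw1.
have rk' : height c.-1.+1 < (mu c.-1).+1 <= height c.-1 by rewrite prednK; lia.
rewrite label_descent // in E; last by lia.
by apply: label_inr_inj E => //; have := @height_anti 1 c.-1; lia.
Qed.

(** * Edges of the tree, column by column *)

Lemma label_leq s : lab s <= (size (boundary pi)).+1.
Proof. by rewrite (leq_trans (count_size _ _)) // size_iota ltnS index_size. Qed.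

(** Column c of the region contains exactly [mu c] crosses of the bottom pipe dream, so the dropped
    dots occupy the rows below [mu c]. *)
Lemma dot_rowsE c : 0 < c <= width -> dot_rows pi c = iota (mu c).+1 (height c - mu c).
Proof.
move=> cw; have h := heightE cw; have hn := height_leq c; have c0 : 0 < c by lia.
suff nd : ndots pi c = height c - mu c.
  by rewrite /dot_rows nd col_lengthE //; congr iota; lia.
rewrite /ndots; set p := fun r => _.
have pE r : p r = [&& 0 < r, r <= height c & ~~ (1 < r <= (mu c).+1)].
  by rewrite /p regionE bottomE c0; lia.
have -> : iota 1 n = iota 1 (1 + (mu c + ((height c - (mu c).+1) + (n - height c)))).
  by congr (iota 1 _); lia.
rewrite !iotaD !count_cat [count _ (iota 1 1)]/= pE /= (leq_trans _ (_ : 0 < height c)) //; last by lia.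
rewrite (@eq_in_count _ _ pred0) ?count_pred0 => [|r]; last by rewrite mem_iota pE /=; lia.
rewrite (@eq_in_count _ p predT) ?count_predT => [|r]; last by rewrite mem_iota pE /=; lia.
rewrite (@eq_in_count _ p pred0) ?count_pred0 => [|r]; last by rewrite mem_iota pE /=; lia.
by rewrite size_iota; lia.
Qed.

Definition column_edges c : seq (nat * nat) :=
  [seq (lab (inl c), lab (inr r)) | r <- iota (mu c).+1 (height c - mu c)].

Definition edges_from c : seq (nat * nat) :=
  flatten [seq column_edges d | d <- iota c (width.+1 - c)].

Lemma tree_edges : tree pi = edges_from 1.
Proof.
rewrite /tree /edges_from subSS subn0; congr flatten; apply/eq_in_map => c.
by rewrite mem_iota add1n ltnS => cw; rewrite dot_rowsE.
Qed.

Lemma edges_from_split c : c <= width ->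
  edges_from c = column_edges c ++ edges_from c.+1.
Proof. by move=> cw; rewrite /edges_from subSn // subSS. Qed.

Lemma edges_from_out : edges_from width.+1 = [::].
Proof. by rewrite /edges_from subnn. Qed.

Lemma edges_fromP e c : 0 < c -> e \in edges_from c -> exists d r,
  [/\ c <= d <= width, mu d < r <= height d & e = (lab (inl d), lab (inr r))].
Proof.
move=> c0 /flattenP[_ /mapP[d dw ->] /mapP[r rd ->]]; exists d, r.
by move: dw rd; rewrite !mem_iota; split=> //; lia.
Qed.

Lemma edges_from_bounded c : 0 < c ->
  all (fun e : nat * nat => e.1 < e.2 < (size (boundary pi)).+2) (edges_from c).
Proof.
move=> c0; apply/allP => e /(edges_fromP c0)[d [r [dw rd ->]]] /=.
by rewrite ltnS label_leq andbT; apply: (@label_inl_inr d d); lia.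
Qed.

(** The order needed by [truncation_tree]: the E step of a column comes before all N steps facing
    dots of this or a later column. *)
Lemma edges_from_sources c : 0 < c ->
  pairwise (fun e e' : nat * nat => e.1 != e'.2) (edges_from c).
Proof.
have H d r r' d' : 0 < d <= d' -> d' <= width -> mu d' < r' <= height d' ->
    (lab (inl d), lab (inr r)).1 != (lab (inl d'), lab (inr r')).2.
  by move=> h1 h2 h3; rewrite /= neq_ltn (@label_inl_inr d d').
move Em : (width.+1 - c) => m; elim: m c Em => [|m IH] c Em c0.
  by rewrite /edges_from Em.
rewrite edges_from_split; last by lia.
rewrite pairwise_cat IH ?andbT; try lia.
apply/andP; split.
  apply/allrelP => _ e' /mapP[r _ ->] /(edges_fromP (ltn0Sn _))[d [r' [dw rd ->]]].
  by apply: H; lia.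
rewrite /column_edges pairwise_map.
apply: (@sub_in_pairwise _ (fun r => mu c < r <= height c) (fun _ _ => true)) => [r r' _ rc _||].
- by apply: H; move: rc; rewrite /in_mem /=; lia.
- by apply/allP => r; rewrite mem_iota; lia.
- by elim: (iota _ _) => //= r s ->; rewrite all_predT.
Qed.

(** This attaches t_c to column c. Every column is a source, for its lowest box, in row [height c],
    always carries a dot. *)
Lemma outgoing_tree : outgoing (tree pi) = [seq lab (inl c) | c <- iota 1 width].
Proof.
have srt : sorted ltn [seq lab (inl c) | c <- iota 1 width].
  rewrite sorted_pairwise; last exact: ltn_trans.
  rewrite pairwise_map; have := iota_ltn_sorted 1 width; rewrite sorted_pairwise; last exact: ltn_trans.
  apply: (@sub_in_pairwise _ (fun c => 0 < c <= width)) => [c d cw dw cd|].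
    by apply: label_inl_lt; move: cw dw; rewrite /in_mem /=; lia.
  by apply/allP => c; rewrite mem_iota; lia.
apply: (sorted_eq leq_trans anti_leq).
- exact: (sort_sorted leq_total).
- by apply: sub_sorted srt => x y; exact: ltnW.
rewrite perm_sort; apply: uniq_perm; first exact: undup_uniq.
  exact: (sorted_uniq ltn_trans ltnn srt).
move=> x; rewrite mem_undup tree_edges; apply/mapP/mapP => [[e /(edges_fromP (ltn0Sn _))[d [r [dw rd ->]] ->]]|[c]].
  by exists d => //; rewrite mem_iota; lia.
rewrite mem_iota => cw ->; have hc := @heightE c.
exists (lab (inl c), lab (inr (height c))) => //.
apply/flattenP; exists (column_edges c); first by apply: map_f; rewrite mem_iota; lia.
by apply: (map_f (fun r => (lab (inl c), lab (inr r)))); rewrite mem_iota; lia.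
Qed.

(** * Evaluation of the tree from its last column *)

Local Open Scope ring_scope.

Variables (K : fieldType) (phi : {rmorphism {poly rat} -> K}).

Local Notation M := (size (boundary pi)).+2.
Local Notation b := (phi beta).
Local Notation eval T e := (tree_eval M phi T e).
Implicit Types (e tau : nat -> K).

(** An edge to a sink s acts on a value independent of e s, where the difference quotient leaves
    just the factor [e l]. Independence is asked only at the points reached by the updates, at which
    a sink keeps its value or takes that of l. *)
Lemma tree_eval_sinks S l T e F : (l < M)%N -> all (fun s => s < M)%N S -> uniq S ->
  {in S, forall s, e s != e l} ->
  (forall e', (forall s, s \notin S -> e' s = e s) ->
     {in S, forall s, e' s = e s \/ e' s = e l} -> eval T e' = F) ->
  eval ([seq (l, s) | s <- S] ++ T) e = e l ^+ size S * F.
Proof.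
move=> lM; elim: S e => [|s S IH] e /=.
  by move=> _ _ _ H; rewrite mul1r; exact: H.
move=> /andP[sM SM] /andP[sS uS] Se H.
have sl : e s != e l by rewrite Se ?mem_head.
have ls : l != s by apply: contraNneq sl => ->.
rewrite tree_eval_cons // 1?eq_sym // !IH //.
- by rewrite /update (negbTE ls) exprS; field; rewrite subr_eq0 eq_sym // eq_sym.
- move=> s' s'S; rewrite /update (negbTE ls); case: (eqVneq s' s) => [E|_]; first by rewrite -E s'S in sS.
  by rewrite Se // inE s'S orbT.
- move=> e' e'1 e'2; apply: H => s'.
    rewrite inE negb_or => /andP[ss s'S]; rewrite e'1 // /update (negbTE ss) //.
  rewrite inE => /predU1P[->|s'S]; first by right; rewrite e'1 // /update eqxx.
  have /negbTE ss : s' != s by apply: contraNneq sS => <-.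
  by have := e'2 _ s'S; rewrite /update ss (negbTE ls).
- by move=> s' s'S; rewrite Se // inE s'S orbT.
- move=> e' e'1 e'2; apply: H => s'.
    by rewrite inE negb_or => /andP[_ s'S]; rewrite e'1.
  rewrite inE => /predU1P[->|s'S]; last exact: e'2.
  by left; rewrite e'1.
Qed.

(** The Grothendieck value, at the inverses of [tau], of the word c followed by the letters above c;
    for c = 1 it is the whole word of the inverse of [pi]. *)
Definition gam tau c : K :=
  groth b (fun i => (tau i)^-1) c (n.+1 - c) (c :: [seq x <- word | (c < x)%N]).

Definition tail_monom tau c : K := \prod_(c <= d < width.+1) tau d ^+ height d.

Lemma eq_tail_monom tau tau' c : (forall d, (c <= d)%N -> tau d = tau' d) ->
  tail_monom tau c = tail_monom tau' c.
Proof. by move=> E; apply: eq_big_nat => d /andP[/E ->]. Qed.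

Lemma tail_monom_next tau c : (c <= width)%N ->
  tail_monom tau c = tau c ^+ height c * tail_monom tau c.+1.
Proof. by move=> cw; rewrite /tail_monom big_ltn. Qed.

Definition tree_value tau c : K := tail_monom tau c * gam tau c.

Lemma eq_groth (xs xs' : nat -> K) c m t : (forall i, (c <= i)%N -> xs i = xs' i) ->
  groth b xs c m t = groth b xs' c m t.
Proof. by move=> E; apply: rows_sum_vars => i /andP[/E]. Qed.

Lemma eq_gam tau tau' c : (forall d, (c <= d)%N -> tau d = tau' d) -> gam tau c = gam tau' c.
Proof. by move=> E; apply: eq_groth => i /E ->. Qed.

Lemma eq_tree_value tau tau' c : (forall d, (c <= d)%N -> tau d = tau' d) ->
  tree_value tau c = tree_value tau' c.
Proof.
by move=> E; rewrite /tree_value (eq_gam E) (eq_tail_monom E).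
Qed.

(** Since [mu width = 0], the letters from [width] on appear in increasing order. *)
Lemma gam_width tau : gam tau width = 1.
Proof.
have v0 := width_gt0; have vn := width_ltn.
rewrite /gam subSn 1?ltnW //= -[RHS](groth_sorted b (fun i => (tau i)^-1) width (n - width).+1).
congr groth; rewrite /=; congr (_ :: _).
have [p [r [E1 E2 sp sr]]] := word_split v0 vn.
have p0 : p = [::] by apply: size0nil; rewrite sp mu_width.
have E3 : [seq x <- word | (width.+1 < x)%N] = r by rewrite E2 p0.
apply: (irr_sorted_eq ltn_trans ltnn); rewrite ?iota_ltn_sorted //.
  rewrite E1 p0 /=; case: (r) sr E3 => //= x r' xr E3; rewrite xr andbT.
  have : x \in [seq x <- word | (width.+1 < x)%N] by rewrite E3 mem_head.
  by rewrite mem_filter => /andP[].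
move=> x; rewrite mem_filter mem_word mem_iota; lia.
Qed.

Lemma gam_recursion tau c : (0 < c < n)%N -> tau c != 0 -> tau c.+1 != 0 ->
  (tau c.+1 - tau c) * (tau c * tau c.+1) ^+ mu c * gam tau c =
  (tau c.+1 + b) * tau c.+1 ^+ mu c * gam tau c.+1 -
  (tau c + b) * tau c ^+ mu c * gam (update tau c.+1 (tau c)) c.+1.
Proof.
move=> /andP[c0 cn] X0 Y0; have [p [r [E1 E2 <- sr]]] := word_split c0 cn.
have cpr : {in p ++ r, forall h, (c.+1 < h)%N}.
  by move=> h; rewrite -E2 mem_filter => /andP[].
have R := groth_recursion b (fun i => (tau i)^-1) (n - c.+1) cpr sr.
rewrite /gam E1 E2; have -> : (n.+1 - c = (n - c.+1).+2)%N by lia.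
have -> : (n.+1 - c.+1 = (n - c.+1).+1)%N by lia.
have <- : groth b (fun i => if i == c.+1 then (tau c)^-1 else (tau i)^-1) c.+1 (n - c.+1).+1 (c.+1 :: p ++ r) =
    groth b (fun i => (update tau c.+1 (tau c) i)^-1) c.+1 (n - c.+1).+1 (c.+1 :: p ++ r).
  by apply: eq_groth => i _; rewrite /update; case: eqP.
move: R; move: (groth _ _ _ _ _) (groth _ _ _ _ _) (groth _ _ _ _ _) => g0 g1 g2.
rewrite exprMn !exprS !exprVn.
have := expf_neq0 (size p) X0; have := expf_neq0 (size p) Y0.
move: (tau c) (tau c.+1) X0 Y0 (_ ^+ _) (_ ^+ _) => X Y X0 Y0 Yp Xp Yp0 Xp0 R.
(* X Y (1/Y - 1/X) = X - Y, which explains the sign; the powers clear the denominators of [R]. *)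
transitivity (- (X * Y * (Xp * Yp)) * ((Y^-1 - X^-1) * g2)).
  by field; rewrite X0 Y0.
by rewrite R; field; rewrite X0 Y0 Xp0 Yp0.
Qed.

Definition is_sink (s : nat) : Prop := forall d, (0 < d <= width)%N -> s <> lab (inl d).

(** Points at which all denominators for the columns from c on are nonzero: [e] gives values to
    vertices, [tau] to columns. *)
Definition generic e tau c : Prop :=
  [/\ forall d, (c <= d <= width)%N -> e (lab (inl d)) = tau d,
      forall d, (c <= d <= width)%N -> tau d != 0,
      forall d d', (c <= d < d')%N -> (d' <= width)%N -> tau d != tau d' &
      forall r d, is_sink (lab (inr r)) -> (0 < r <= height c)%N ->
        (c <= d <= width)%N -> e (lab (inr r)) != tau d].

Lemma is_sink_row c r : (0 < c <= width)%N -> (mu c < r.-1)%N -> (r <= height c)%N ->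
  is_sink (lab (inr r)).
Proof.
move=> cw rc rh d dw /(label_inr_inl dw) H; have h := heightE cw.
have [d1 md Er] : [/\ (1 < d)%N, (mu d < mu d.-1)%N & r = (mu d.-1).+1].
  by apply: H; have := @height_anti 1 c; lia.
case: (leqP c d.-1) => [cd|dc]; first by have := @mu_anti c d.-1; lia.
by have := @mu_anti d.-1 c.-1; lia.
Qed.

Lemma is_sink_row1 : is_sink (lab (inr 1%N)).
Proof.
move=> d dw /(label_inr_inl dw) [|_ md]; first by have := @heightE 1; have := width_gt0; lia.
by case E : (mu d.-1) md.
Qed.

(** [mu] is positive before column [width] and zero there, so it drops. By [label_descent], the E
    step of column h carries the label of row [mu c + 1], the row of the first dot of column c. *)
Lemma next_descent c : (0 < c < width)%N ->
  exists h, [/\ (c < h <= width)%N, (mu h < mu h.-1)%N & mu h.-1 = mu c].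
Proof.
move Em : (width - c)%N => m; elim: m c Em => [|m IH] c Em cw; first by lia.
have c0 : (0 < c)%N by lia.
have := mu_leq c0; rewrite leq_eqVlt => /predU1P[E|lt]; last first.
  by exists c.+1; split=> //; lia.
have c1w : (0 < c.+1 < width)%N.
  by case: (ltnP c.+1 width) => // h; have := @mu_gt0 c cw; rewrite -E (_ : c.+1 = width) ?mu_width //; lia.
have [|h [h1 h2 h3]] := IH c.+1 _ c1w; first by lia.
by exists h; split=> //; [lia|rewrite h3].
Qed.

Lemma label_bound s : (lab s < M)%N.
Proof. by rewrite ltnS label_leq. Qed.

Lemma generic_next e tau c : (0 < c)%N -> generic e tau c -> generic e tau c.+1.
Proof.
move=> c0 [h1 h2 h3 h4].
split=> [d dc|d dc|d d' dc|r d rs rc dc]; [apply: h1|apply: h2|apply: h3|apply: h4] => //; try lia.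
by have := height_anti c0 (leqnSn c); lia.
Qed.

Lemma label_inl_inj c d : (0 < c <= width)%N -> (0 < d <= width)%N ->
  (lab (inl c) == lab (inl d)) = (c == d).
Proof.
move=> cw dw; case: (ltngtP c d) => [cd|dc|->]; last exact: eqxx.
  by have := @label_inl_lt c d; lia.
by have := @label_inl_lt d c; lia.
Qed.

Lemma generic_update e tau c h u : (0 < c)%N -> (0 < h <= width)%N -> u != 0 ->
  generic e tau c -> (forall d, (c <= d <= width)%N -> d != h -> u != tau d) ->
  (forall r, is_sink (lab (inr r)) -> (0 < r <= height c)%N -> e (lab (inr r)) != u) ->
  generic (update e (lab (inl h)) u) (update tau h u) c.
Proof.
move=> c0 hw u0 [h1 h2 h3 h4] ud us; split.
- move=> d dc; rewrite /update label_inl_inj //; last by lia.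
  by case: (d == h) => //; exact: h1.
- by move=> d dc; rewrite /update; case: (d == h) => //; exact: h2.
- move=> d d' dc d'w; rewrite /update.
  case: (eqVneq d h) => [dh|dh]; case: (eqVneq d' h) => [d'h|d'h].
  + by move: dc; rewrite dh d'h ltnn andbF.
  + by apply: ud => //; lia.
  + by rewrite eq_sym; apply: ud => //; lia.
  + exact: h3.
move=> r d rs rc dc; rewrite /update; have /eqP/negbTE -> := rs h hw.
by case: (d == h); [exact: us|exact: h4].
Qed.

(** Genericity survives only from c+1 on, as columns c and h now share a value. *)
Lemma generic_jump e tau c h : (0 < c < h)%N -> (h <= width)%N -> generic e tau c ->
  generic (update e (lab (inl h)) (tau c)) (update tau h (tau c)) c.+1.
Proof.
move=> ch hw G; have [h1 h2 h3 h4] := G; have c0 : (0 < c)%N by lia.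
have hw1 : (0 < h <= width)%N by lia.
apply: generic_update => //; [by apply: h2; lia|exact: generic_next| |].
- by move=> d dc dh; apply: h3; lia.
- move=> r rs rc; apply: h4 => //; last by lia.
  by have := height_anti c0 (leqnSn c); lia.
Qed.

Lemma eval_sinks c e tau u F m : (0 < c <= width)%N -> generic e tau c.+1 ->
  (forall e', generic e' tau c.+1 -> eval (edges_from c.+1) e' = F) ->
  e (lab (inl c)) = u -> (0 < m)%N -> (height c.+1 < m)%N ->
  (forall r, (m <= r <= height c)%N -> is_sink (lab (inr r)) /\ e (lab (inr r)) != u) ->
  eval ([seq (lab (inl c), lab (inr r)) | r <- iota m ((height c).+1 - m)] ++ edges_from c.+1) e =
  u ^+ ((height c).+1 - m) * F.
Proof.
move=> cw G IH eu m0 mc sk; have [h1 h2 h3 h4] := G.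
have hc1 : (height c <= height 1)%N by apply: height_anti; lia.
pose S := [seq lab (inr r) | r <- iota m ((height c).+1 - m)].
have -> : [seq (lab (inl c), lab (inr r)) | r <- iota m ((height c).+1 - m)] =
    [seq (lab (inl c), s) | s <- S] by rewrite -map_comp.
have SP s : s \in S -> exists2 r, (m <= r <= height c)%N & s = lab (inr r).
  by move=> /mapP[r rm ->]; exists r => //; move: rm; rewrite mem_iota; lia.
rewrite (@tree_eval_sinks S _ _ _ F) ?label_bound //.
- by rewrite eu size_map size_iota.
- by apply/allP => _ /mapP[r _ ->]; exact: label_bound.
- rewrite map_inj_in_uniq ?iota_uniq // => r r' rm rm' E.
  by apply: label_inr_inj E; move: rm rm'; rewrite !mem_iota; lia.
- by move=> _ /SP[r rm ->]; rewrite eu; have [] := sk r rm.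
move=> e' e'1 _; apply: IH; split=> // [d dc|r d rs rc dc].
- rewrite e'1; first by apply: h1; lia.
  by apply/negP => /SP[r /sk[rs _] E]; apply: (rs d) => //; lia.
rewrite e'1; first exact: h4.
apply/negP => /SP[r' rm' E]; suff : r = r' by lia.
by apply: label_inr_inj E; lia.
Qed.

(* The first edge of column c leads to the vertex of column h; the other edges of
   the column lead to sinks. *)
Lemma eval_column c h e tau : (0 < c < h)%N -> (h <= width)%N ->
  (mu h < mu h.-1)%N -> mu h.-1 = mu c -> generic e tau c ->
  (forall e' tau', generic e' tau' c.+1 -> eval (edges_from c.+1) e' = tree_value tau' c.+1) ->
  eval (edges_from c) e =
  tau c ^+ (height c - mu c) / (tau h - tau c) *
   ((tau h + b) * tree_value tau c.+1 -
    (tau c + b) * tree_value (update tau h (tau c)) c.+1).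
Proof.
move=> ch hw hd hc G IH; have [h1 h2 h3 h4] := G.
have cw : (0 < c <= width)%N by lia.
have hw1 : (0 < h <= width)%N by lia.
have c1w : (0 < c.+1 <= width)%N by lia.
have hcE := heightE cw; have hcE' := heightE c1w; have hw' : (1 < h <= width)%N by lia.
have m1 : (mu c.+1 <= mu c)%N by apply: mu_leq; lia.
rewrite edges_from_split /column_edges; last by lia.
have Em : (height c - mu c = ((height c).+1 - (mu c).+2).+1)%N by lia.
rewrite Em /= -hc -(label_descent hw' hd) hc.
have ec : e (lab (inl c)) = tau c by apply: h1; lia.
have eh : e (lab (inl h)) = tau h by apply: h1; lia.
have nch : tau c != tau h by apply: h3; lia.
have sinks r : ((mu c).+2 <= r <= height c)%N -> is_sink (lab (inr r)).
  by move=> rc; apply: (@is_sink_row c); lia.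
have G1 := generic_next (proj1 (andP cw)) G.
have G2 := generic_jump ch hw G.
rewrite tree_eval_cons ?label_bound ?ec ?eh //.
rewrite (eval_sinks (F := tree_value tau c.+1) cw G1 _ ec) //; first 1 last.
- by move=> e'; exact: IH.
- by rewrite /= in hcE'; lia.
- by move=> r rc; split; [exact: sinks|apply: h4; [exact: sinks|lia|lia]].
rewrite (eval_sinks (u := tau c) (F := tree_value (update tau h (tau c)) c.+1) cw G2) //; first 1 last.
- by move=> e'; exact: IH.
- by rewrite /update label_inl_inj ?(ltn_eqF (proj2 (andP ch))) //; lia.
- by rewrite /= in hcE'; lia.
- move=> r rc; split; first exact: sinks.
  rewrite /update; have /eqP/negbTE -> := sinks r rc h hw1.
  by apply: h4; [exact: sinks|lia|lia].
rewrite exprS; move: (tree_value _ _) (tree_value _ _) (_ ^+ _) => v1 v2 u.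
by field; rewrite subr_eq0 eq_sym.
Qed.

Lemma update_same tau h u : update tau h u h = u.
Proof. by rewrite /update eqxx. Qed.

Lemma update_neq tau h u d : d != h -> update tau h u d = tau d.
Proof. by rewrite /update => /negbTE ->. Qed.

Lemma eval_edges_last e tau : generic e tau width ->
  eval (edges_from width) e = tree_value tau width.
Proof.
move=> G; have v0 := width_gt0; have [h1 _ _ h4] := G.
have vv : (0 < width <= width)%N by rewrite v0 leqnn.
have hS : height width.+1 = 0%N.
  by have := @leq_width width.+1; have := width_ltn; rewrite ltnn; lia.
have sinks r : (0 < r <= height width)%N -> is_sink (lab (inr r)).
  case: r => [|[|r]] rw //; first exact: is_sink_row1.
  by apply: (is_sink_row vv); [rewrite mu_width|lia].
rewrite edges_from_split // /column_edges mu_width subn0.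
have -> : height width = ((height width).+1 - 1)%N by rewrite subn1.
rewrite (eval_sinks (u := tau width) (F := 1) vv (generic_next v0 G)) ?hS //.
- by rewrite mulr1 /tree_value /tail_monom big_nat1 gam_width mulr1 subn1.
- by move=> e' _; rewrite edges_from_out tree_eval_nil.
- by apply: h1; lia.
by move=> r rw; split; [exact: sinks|apply: h4; [exact: sinks| |]; lia].
Qed.

(** Here h = c+1, and the column formula is [gam_recursion] up to monomial factors. *)
Lemma eval_edges_descent c e tau : (0 < c < width)%N -> (mu c.+1 < mu c)%N ->
  generic e tau c ->
  (forall e' tau', generic e' tau' c.+1 -> eval (edges_from c.+1) e' = tree_value tau' c.+1) ->
  eval (edges_from c) e = tree_value tau c.
Proof.
move=> cw md G IH; have [_ h2 h3 _] := G.
rewrite (@eval_column c c.+1 _ _ _ _ _ _ G IH) //; try lia.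
have nz : tau c.+1 - tau c != 0 by rewrite subr_eq0 eq_sym; apply: h3; lia.
have cn := width_ltn; have cn' : (0 < c < n)%N by lia.
have X0 : tau c != 0 by apply: h2; lia.
have Y0 : tau c.+1 != 0 by apply: h2; lia.
have rec := gam_recursion cn' X0 Y0.
have hc1 : height c.+1 = mu c by rewrite heightE /=; lia.
have hc : height c = ((height c - mu c).-1 + (mu c).+1)%N by rewrite heightE; lia.
rewrite /tree_value (tail_monom_next tau (c := c)) ?(tail_monom_next tau (c := c.+1)); try lia.
rewrite (tail_monom_next (update _ _ _)) ?update_same ?hc1; last by lia.
rewrite -(@eq_tail_monom tau (update _ _ _)); last first.
  by move=> d cd; rewrite update_neq // gtn_eqF.
have -> : (height c - mu c = (height c - mu c).-1.+1)%N by lia.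
set k := (height c - mu c).-1 in hc *; rewrite hc; clear hc; clearbody k.
move: rec nz; move: (tail_monom _ _) (mu c) => R a.
move: (gam tau c) (gam tau c.+1) (gam (update _ _ _) c.+1) => g0 g1 g2.
move: (tau c) (tau c.+1) => X Y rec nz.
transitivity (X ^+ k.+1 * R * ((Y - X) * (X * Y) ^+ a * g0) / (Y - X)).
  by rewrite rec; field.
by rewrite exprMn exprD !exprS; field.
Qed.

(** Columns c and c+1 point to the same h, and column c+1 has a single dot. The column formula for c
    involves t_h, whereas [gam_recursion] involves t_(c+1); both are reduced to values of the tree
    from column c+2 on. *)
Lemma eval_edges_flat c e tau : (0 < c < width)%N -> mu c.+1 = mu c ->
  generic e tau c ->
  (forall e' tau', generic e' tau' c.+1 -> eval (edges_from c.+1) e' = tree_value tau' c.+1) ->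
  (forall e' tau', generic e' tau' c.+2 -> eval (edges_from c.+2) e' = tree_value tau' c.+2) ->
  eval (edges_from c) e = tree_value tau c.
Proof.
move=> cw mE G IH1 IH2; have [_ h2 h3 _] := G.
have c1w : (0 < c.+1 < width)%N.
  by case: (ltnP c.+1 width) => // h; have := @mu_gt0 c cw; rewrite -mE (_ : c.+1 = width) ?mu_width //; lia.
have [h [ch hd hE]] := next_descent c1w.
have cw' : (0 < c <= width)%N by lia.
have c1w' : (0 < c.+1 <= width)%N by lia.
have hw : (0 < h <= width)%N by lia.
have hc1 : height c.+1 = (mu c).+1 by have := heightE c1w'; rewrite /= mE; lia.
have hc : height c = ((height c - mu c).-1 + (mu c).+1)%N by have := heightE cw'; lia.
have X0 : tau c != 0 by apply: h2; lia.
have Y0 : tau c.+1 != 0 by apply: h2; lia.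
have cn := width_ltn; have cn' : (0 < c < n)%N by lia.
have rec := gam_recursion cn' X0 Y0.
have XY : tau c.+1 - tau c != 0 by rewrite subr_eq0 eq_sym; apply: h3; lia.
have XZ : tau h - tau c != 0 by rewrite subr_eq0 eq_sym; apply: h3; lia.
have YZ : tau h - tau c.+1 != 0 by rewrite subr_eq0 eq_sym; apply: h3; lia.
have G1 := generic_next (proj1 (andP cw)) G.
have step e' tau' : generic e' tau' c.+1 -> tree_value tau' c.+1 =
    tau' c.+1 / (tau' h - tau' c.+1) * ((tau' h + b) * tree_value tau' c.+2 -
    (tau' c.+1 + b) * tree_value (update tau' h (tau' c.+1)) c.+2).
  move=> G'; rewrite -(IH1 _ _ G') (@eval_column c.+1 h _ _ _ _ _ _ G') //; try lia.
  by rewrite hc1 mE subSn // subnn expr1.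
have ch' : (0 < c < h)%N by lia.
have hw' : (h <= width)%N by lia.
have hc1' : (h == c.+1) = false by rewrite gtn_eqF; lia.
(* Column c+1 is expanded at [tau], at t_h := t_c and at t_(c+1) := t_c. Only three values from
   column c+2 on occur: at [tau], at t_h := t_(c+1) and at t_h := t_c. *)
have step1 := step _ _ G1.
have step2 := step _ _ (generic_jump ch' hw' G).
have c1w'' : (c.+1 <= width)%N by lia.
have cc : (0 < c < c.+1)%N by lia.
have step3 := step _ _ (generic_jump cc c1w'' G).
rewrite (@eval_column c h _ _ _ _ _ _ G IH1) //; try lia.
rewrite update_same (@update_neq _ _ _ c.+1) ?(eq_sym c.+1) ?hc1' // in step2.
rewrite update_same (@update_neq _ _ _ h) ?hc1' // in step3.
set X := tau c in X0 XY XZ rec step2 step3 *; set Y := tau c.+1 in Y0 XY YZ rec step1 step2 step3 *.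
set Z := tau h in XZ YZ step1 step2 step3 *.
rewrite (@eq_tree_value (update (update tau h X) h Y) (update tau h Y)) in step2; last first.
  by move=> d _; rewrite /update; case: eqP.
rewrite (@eq_tree_value (update tau c.+1 X) tau c.+2) in step3; last first.
  by move=> d dc; rewrite update_neq // gtn_eqF.
rewrite (@eq_tree_value (update (update tau c.+1 X) h X) (update tau h X) c.+2) in step3; last first.
  by move=> d dc; rewrite /update; do ! case: eqP => //; lia.
have F1 : tree_value tau c.+1 = Y ^+ (mu c).+1 * tail_monom tau c.+2 * gam tau c.+1.
  by rewrite /tree_value tail_monom_next ?hc1.
have F3 : tree_value (update tau c.+1 X) c.+1 =
    X ^+ (mu c).+1 * tail_monom tau c.+2 * gam (update tau c.+1 X) c.+1.
  rewrite /tree_value tail_monom_next // update_same hc1; congr (_ * _ * _).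
  by apply: eq_tail_monom => d dc; rewrite update_neq // gtn_eqF.
have F0 : tree_value tau c =
    X ^+ height c * (Y ^+ (mu c).+1 * tail_monom tau c.+2) * gam tau c.
  by rewrite /tree_value (tail_monom_next tau (proj2 (andP cw'))) (tail_monom_next tau c1w'') hc1.
have hk : (height c - mu c = (height c - mu c).-1.+1)%N by lia.
rewrite F0 hk; set k := (height c - mu c).-1 in hc *; rewrite hc; clear hc hk; clearbody k.
rewrite step2; rewrite F1 in step1 *; rewrite F3 in step3.
clear F0 F1 F3; move: rec step1 step2 step3.
move: (tail_monom _ _) (mu c) => R a.
move: (gam tau c) (gam tau c.+1) (gam (update _ _ _) c.+1) => g0 g1 g2.
move: (tree_value _ _) (tree_value _ _) (tree_value _ _) => A B C.
clear X0 Y0; move: XY XZ YZ; clearbody X Y Z => XY XZ YZ rec step1 step2 step3.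
(* [gam_recursion] with the monomials restored, so that its right-hand side contains the two values
   given by [step1] and [step3]. *)
have star : (Y - X) * (X ^+ (k + a.+1) * (Y ^+ a.+1 * R) * g0) =
    X ^+ k * (X * (Y + b) * (Y ^+ a.+1 * R * g1) - Y * (X + b) * (X ^+ a.+1 * R * g2)).
  transitivity (X ^+ k * X * Y * R * ((Y - X) * (X * Y) ^+ a * g0)).
    by rewrite exprMn exprD !exprS; ring.
  by rewrite rec !exprS; ring.
apply: (mulfI XY); rewrite star step1 step3 exprS.
have XY' : X - Y != 0 by rewrite -oppr_eq0 opprB.
by field; rewrite XZ YZ XY'.
Qed.

Lemma eval_edges c e tau : (0 < c <= width)%N -> generic e tau c ->
  eval (edges_from c) e = tree_value tau c.
Proof.
move Em : (width - c)%N => m; elim/ltn_ind: m c e tau Em => m IH c e tau Em cw G.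
have IH' d e' tau' : (c < d)%N -> (d <= width)%N -> generic e' tau' d ->
    eval (edges_from d) e' = tree_value tau' d.
  by move=> cd dw; apply: (IH (width - d)%N); lia.
case: (ltnP c width) => cw'; last first.
  have E : c = width by lia.
  by move: G; rewrite E; exact: eval_edges_last.
have IH1 e' tau' : generic e' tau' c.+1 -> eval (edges_from c.+1) e' = tree_value tau' c.+1.
  by apply: IH'.
have c0 : (0 < c < width)%N by lia.
have := mu_leq (proj1 (andP cw)); rewrite leq_eqVlt => /predU1P[mE|md]; last first.
  exact: eval_edges_descent.
apply: eval_edges_flat => // e' tau'; apply: IH' => //.
by case: (ltnP c.+1 width) => // h; have := mu_gt0 c0; rewrite -mE (_ : c.+1 = width) ?mu_width //; lia.
Qed.

End Dominant.

(** * Inversion of the variables *)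

Section RationalFunctions.

Local Open Scope ring_scope.

Variable N : nat.

Definition ratfun_const : {rmorphism {poly rat} -> ratfun N} :=
  @FracField.tofrac {mpoly {poly rat}[N]} \o @mpolyC N {poly rat}.

Lemma to_ratfun_tsubst T p :
  to_ratfun (tsubst N T p) = monalg.mmap ratfun_const
    (source_monom (fun i => to_ratfun (tvar N (index i (outgoing T))))) p.
Proof.
rewrite /tsubst !monalg.mmapE /to_ratfun rmorph_sum; apply: eq_bigr => m _.
rewrite rmorphM; congr (_ * _); rewrite /source_monom rmorph_prod.
by apply: eq_bigr => e _; rewrite rmorphXn.
Qed.

Lemma tvar_ord (i : 'I_N) : tvar N i = 'X_i.
Proof. by rewrite /tvar valK. Qed.

Lemma tvar_neq i j : (i < N)%N -> i != j -> tvar N i != tvar N j.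
Proof.
move=> iN ij; rewrite (tvar_ord (Ordinal iN)) /tvar.
case: insubP => [j' _ E|_].
  have := @mpolyX_sub_neq0 N j' (Ordinal iN); rewrite subr_eq0; apply.
  by rewrite -val_eqE E eq_sym.
apply/eqP => /(congr1 (fun p : {mpoly {poly rat}[N]} => p@_U_(Ordinal iN)%MM)) /eqP.
by rewrite mcoeffX eqxx mcoeff0 oner_eq0.
Qed.

Lemma tvar_neq0 i : (i < N)%N -> tvar N i != 0.
Proof.
move=> iN; have := @tvar_neq i N iN; rewrite [tvar N N]/tvar insubF ?ltnn //; apply.
by rewrite ltn_eqF.
Qed.

End RationalFunctions.

Section Main.

Local Open Scope ring_scope.

Variables (n : nat) (pi : 'S_n).
Hypotheses (n_gt1 : (1 < n)%N) (dom : one_dominant pi).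

Local Notation width := (row_length pi 1).
Local Notation lab := (label pi).
Local Notation N := n.-1.

Let tau (d : nat) : ratfun N := to_ratfun (tvar N d.-1).
Let e (i : nat) : ratfun N := to_ratfun (tvar N (index i (outgoing (tree pi)))).

Lemma generic_labels : generic pi e tau 1.
Proof.
have wn := width_ltn n_gt1 dom.
have inj i j : (i < N)%N -> i != j -> to_ratfun (tvar N i) != to_ratfun (tvar N j).
  by move=> iN ij; rewrite /to_ratfun tofrac_eq tvar_neq.
split=> [d dw|d dw|d d' dw d'w|r d rs rw dw].
- have <- : nth 0%N [seq lab (inl c) | c <- iota 1 width] d.-1 = lab (inl d).
    by rewrite (nth_map 0%N) ?size_iota ?nth_iota; try lia; congr (lab (inl _)); lia.
  rewrite /e /tau outgoing_tree // index_uniq ?size_map ?size_iota //; try lia.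
  rewrite map_inj_in_uniq ?iota_uniq // => c c'; rewrite !mem_iota => cw cw' /eqP.
  by rewrite label_inl_inj // => /eqP.
- by rewrite /tau /to_ratfun tofrac_eq0 tvar_neq0 //; lia.
- by apply: inj; lia.
(* A sink is absent from [outgoing], so its index is [width]; [tvar] then gives a variable attached
   to no column of the region, or 0, and either differs from every [tau d]. *)
rewrite eq_sym /e memNindex ?outgoing_tree ?size_map ?size_iota //; last first.
  by apply/mapP => -[d']; rewrite mem_iota => dw' E; apply: (rs d') => //; lia.
by apply: inj; lia.
Qed.

Lemma eval_inv_Grothendieck : eval_inv (Grothendieck (pi^-1)%g) = gam pi (@ratfun_const N) tau 1.
Proof.
rewrite /gam subn1 /=; have -> : 1%N :: [seq x <- word pi | (1 < x)%N] = oneline (pi^-1)%g.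
  have := nth0_word n_gt1 dom; have := word_uniq pi n_gt1; have := mem_word pi n_gt1.
  rewrite /word; case: (oneline _) => [|x s] //= wE /andP[xs _] x1.
  rewrite x1 /= in xs *; congr (_ :: _); apply/all_filterP/allP => y ys.
  have := wE y; rewrite inE ys orbT; case: (y =P 1%N) => [y1|]; last by lia.
  by rewrite -y1 ys in xs.
rewrite -(eval_Grothendieck _ (@ratfun_const N) (fun i => (tau i)^-1)).
rewrite /eval_inv; apply: eq_bigr => m _; congr (_ * _); apply: eq_bigr => i _.
by rewrite /tau /= tvar_ord.
Qed.

Lemma prod_heights : \prod_(i < N) to_ratfun 'X_i ^+ col_length pi i.+1 =
  \prod_(1 <= d < width.+1) tau d ^+ height pi d.
Proof.
have wn := width_ltn n_gt1 dom.
have hz d : (width < d)%N -> (d <= n)%N -> height pi d = 0%N.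
  by move=> wd dn; have := @leq_width n pi n_gt1 dom d; lia.
transitivity (\prod_(1 <= d < n) tau d ^+ height pi d).
  rewrite big_add1 big_mkord; apply: eq_bigr => i _.
  by rewrite col_lengthE // /tau /= tvar_ord.
rewrite (big_cat_nat (n := width.+1)) //= [X in _ * X]big_nat [X in _ * X]big1 ?mulr1 // => d dw.
by rewrite hz ?expr0 //; lia.
Qed.

End Main.

Theorem theorem5p3 (n : nat) (pi : 'S_n) (p : xpoly) :
  1 < n ->
  one_dominant pi ->
  reduced_form (tree_monom (tree pi)) p ->
  to_ratfun (tsubst n.-1 (tree pi) p) =
  ((\prod_(i < n.-1) to_ratfun 'X_i ^+ col_length pi i.+1) *
     eval_inv (Grothendieck (pi^-1)%g))%R.
Proof.
move=> n1 dom red; rewrite to_ratfun_tsubst prod_heights // eval_inv_Grothendieck //.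
rewrite tree_edges // in red.
rewrite (tree_eval_reduced_form _ _ (edges_from_bounded n1 dom (ltn0Sn 0))
  (edges_from_sources n1 dom (ltn0Sn 0)) red).
exact: (eval_edges n1 dom (ratfun_const _) (c := 1) (width_gt0 n1 dom)
  (generic_labels n1 dom)).
Qed.
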